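(* Let $N\ge1$, $\lambda>0$, $B_1=\{x\in\mathbb{R}^N:\|x\|_2<1\}$, and let $u_0$ be a continuous function on $\overline{B_1}$ with $0\le u_0<1$ that is radially symmetric and radially decreasing (i.e. $u_0=u_0(r)$, $r=\|x\|_2$, with $u_0'(r)\le0$). Suppose that the solution $u$ of $$u_t-\Delta u=\frac{\lambda}{(1-u)^2\left(1+\int_{B_1}\frac{dx}{1-u}\right)^2}\ \text{ in } B_1\times(0,T),\qquad u=0\ \text{ on }\partial B_1\times(0,T),\qquad u(x,0)=u_0(x),\ x\in B_1,$$ quenches in finite time $T_q<\infty$. Then the quenching occurs only at the origin $r=0$; that is, the quenching set of $u$ is $\{0\}$.
   Context: The parabolic problem has a local-in-time solution, which is radial ($u=u(r,t)$, $u_r(0,t)=0$); it exists as long as $u<1$ and ceases to exist once $u$ reaches $1$. The solution quenches in finite time $0<T_q<\infty$ (at $x^*$) if there exist sequences $x_n\in B_1$, $t_n\in(0,\infty)$ with $x_n\to x^*$, $t_n\to T_q$ and $u(x_n,t_n)\to1^-$. The quenching set is $$\mathcal{Q}=\{x^*\in\overline{B_1}:\ \text{there is a sequence }(x_k,t_k)\in B_1\times(0,T_q)\text{ with } x_k\to x^*,\ t_k\to T_q,\ u(x_k,t_k)\to1\text{ as }k\to\infty\}.$$ *)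

(* Defs.v *)
From HB Require Import structures.
From mathcomp Require Import all_boot all_order all_algebra.
From mathcomp Require Import all_classical all_reals all_analysis.

Set Implicit Arguments.
Unset Strict Implicit.
Unset Printing Implicit Defensive.

Import Order.TTheory GRing.Theory Num.Theory.
Import numFieldNormedType.Exports.

Local Open Scope classical_set_scope.
Local Open Scope ring_scope.

Section lebesgue_tuple_succ.
Local Open Scope ereal_scope.
Context (R : realType) (n : nat).
Local Notation T := (measurableTypeR R).
Variable mu : {sigma_finite_measure set (n.-tuple T) -> \bar R}.

Definition tuple_cons (p : T * n.-tuple T) : n.+1.-tuple T :=
  [tuple of p.1 :: p.2].

Lemma measurable_tuple_cons : measurable_fun [set: T * n.-tuple T] tuple_cons.
Proof. exact: measurable_cons. Qed.

Definition lebesgue_tuple_succ : set (n.+1.-tuple T) -> \bar R :=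
  pushforward (@lebesgue_measure R \x mu) tuple_cons.

Let measurable_preimage (A : set (n.+1.-tuple T)) :
  measurable A -> measurable (tuple_cons @^-1` A).
Proof.
by move=> mA; rewrite -[X in measurable X]setTI; exact: measurable_tuple_cons.
Qed.

Let lebesgue_tuple_succ0 : lebesgue_tuple_succ set0 = 0.
Proof. by rewrite /lebesgue_tuple_succ /pushforward preimage_set0 measure0. Qed.

Let lebesgue_tuple_succ_ge0 A : 0 <= lebesgue_tuple_succ A.
Proof. by rewrite /lebesgue_tuple_succ /pushforward; exact: measure_ge0. Qed.

Let lebesgue_tuple_succ_sigma_additive : semi_sigma_additive lebesgue_tuple_succ.
Proof.
move=> F mF tF mUF; rewrite /lebesgue_tuple_succ /pushforward preimage_bigcup.
apply: measure_semi_sigma_additive.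
- by move=> i; exact: measurable_preimage.
- apply/trivIsetP => /= i j _ _ ij; rewrite -preimage_setI.
  by move/trivIsetP : tF => /(_ _ _ _ _ ij) ->//; rewrite preimage_set0.
- by rewrite -preimage_bigcup; exact: measurable_preimage.
Qed.

HB.instance Definition _ := isMeasure.Build _ _ _ lebesgue_tuple_succ
  lebesgue_tuple_succ0 lebesgue_tuple_succ_ge0
  lebesgue_tuple_succ_sigma_additive.

Let lebesgue_tuple_succ_sigma_finite : sigma_finite setT lebesgue_tuple_succ.
Proof.
pose uncons (x : n.+1.-tuple T) : T * n.-tuple T :=
  (thead x, [tuple of behead x]).
have muncons : measurable_fun setT uncons.
  apply/measurable_fun_pairP; split.
    exact: (measurable_tnth ord0).
  exact: measurable_behead.
have unconsK p : uncons (tuple_cons p) = p.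
  case: p => a b; rewrite /uncons /tuple_cons /=; congr pair.
  exact/val_inj.
have [F FT Ffin] : sigma_finite setT (@lebesgue_measure R \x mu).
  have /sigma_finiteP[F [TF ndF Foo]] := sigma_finiteT (@lebesgue_measure R).
  have /sigma_finiteP[G [TG ndG Goo]] := sigma_finiteT mu.
  exists (fun k => F k `*` G k).
    rewrite -setXTT TF TG predeqE => -[x y]; split.
      move=> [/= [k _ Fkx] [l _ Gly]]; exists (maxn k l) => //; split.
      - by move: x Fkx; exact/subsetPset/ndF/leq_maxl.
      - by move: y Gly; exact/subsetPset/ndG/leq_maxr.
    by move=> [k _ []/= ? ?]; split; exists k.
  move=> k; have [? ?] := Foo k; have [? ?] := Goo k.
  split; first exact: measurableX.
  by rewrite product_measure1E// lte_mul_pinfty// ge0_fin_numE.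
exists (fun i => uncons @^-1` F i) => [|i].
  by rewrite -preimage_bigcup -FT preimage_setT.
have [mF Foo] := Ffin i; split.
  by rewrite -[X in measurable X]setTI; exact: muncons.
rewrite /lebesgue_tuple_succ /pushforward.
rewrite (_ : tuple_cons @^-1` (uncons @^-1` F i) = F i)//.
by apply/seteqP; split=> p /=; rewrite unconsK.
Qed.

HB.instance Definition _ := Measure_isSigmaFinite.Build _ _ _
  lebesgue_tuple_succ lebesgue_tuple_succ_sigma_finite.

End lebesgue_tuple_succ.

(* The n-dimensional Lebesgue measure, on the Borel sets of R^n presented as
   n-tuples: the n-fold product of the one-dimensional Lebesgue measure. *)
Fixpoint lebesgue_tuple (R : realType) (n : nat) :
    {sigma_finite_measure set (n.-tuple (measurableTypeR R)) -> \bar R} :=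
  match n with
  | 0 => \d_([tuple] : 0.-tuple (measurableTypeR R))
  | m.+1 => lebesgue_tuple_succ (lebesgue_tuple R m)
  end.

Section mems.
Context (R : realType) (N : nat).
Implicit Types (x y : 'rV[R]_N) (t : R).

(* The library norm on 'rV[R]_N is the sup norm; it induces the same topology
   as the Euclidean one. *)
Definition enorm x : R := Num.sqrt (\sum_(i < N) x ord0 i ^+ 2).

Definition unit_ball : set 'rV[R]_N := [set x | enorm x < 1].
Definition closed_unit_ball : set 'rV[R]_N := [set x | enorm x <= 1].
Definition unit_sphere : set 'rV[R]_N := [set x | enorm x = 1].

Definition row_of_tuple (z : N.-tuple (measurableTypeR R)) : 'rV[R]_N :=
  \row_(i < N) tnth z i.

Definition integral_unit_ball (f : 'rV[R]_N -> R) : R :=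
  \int[lebesgue_tuple R N]_(z in row_of_tuple @^-1` unit_ball)
    f (row_of_tuple z).

Definition partial (i : 'I_N) (f : 'rV[R]_N -> R) x : R :=
  'D_(delta_mx ord0 i) f x.

Definition laplacian (f : 'rV[R]_N -> R) x : R :=
  \sum_(i < N) partial i (partial i f) x.

Definition radially_decreasing (f : 'rV[R]_N -> R) :=
  exists2 phi : R -> R,
    forall x, closed_unit_ball x -> f x = phi (enorm x) &
    forall r s, 0 <= r -> r <= s -> s <= 1 -> phi s <= phi r.

Definition space_time (A : set 'rV[R]_N) (I : set R) : set ('rV[R]_N * R) :=
  [set p | A p.1 /\ I p.2].

Record C21 (T : R) (f : 'rV[R]_N -> R -> R) : Prop := {
  C21_dt : forall x t, unit_ball x -> 0 < t < T -> derivable (f x) t 1;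
  C21_dx : forall i x t, unit_ball x -> 0 < t < T ->
    derivable (f ^~ t) x (delta_mx ord0 i);
  C21_dxx : forall i j x t, unit_ball x -> 0 < t < T ->
    derivable (partial i (f ^~ t)) x (delta_mx ord0 j);
  C21_cont : {within space_time unit_ball `]0, T[,
    continuous (fun p => f p.1 p.2)};
  C21_cont_dt : {within space_time unit_ball `]0, T[,
    continuous (fun p => derive1 (f p.1) p.2)};
  C21_cont_dx : forall i, {within space_time unit_ball `]0, T[,
    continuous (fun p => partial i (f ^~ p.2) p.1)};
  C21_cont_dxx : forall i j, {within space_time unit_ball `]0, T[,
    continuous (fun p => partial j (partial i (f ^~ p.2)) p.1)} }.

(* Classical solutions on B_1 x (0, T). The initial datum need not vanish on
   the unit sphere, so that u is not required to be continuous at the corner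
   (unit sphere) x {0}; it is only required to stay bounded there, below the
   singular value 1. *)
Record mems_solution (lam : R) (u0 : 'rV[R]_N -> R) (T : R)
    (u : 'rV[R]_N -> R -> R) : Prop := {
  mems_C21 : C21 T u;
  mems_continuous : {within space_time closed_unit_ball `]0, T[ `|`
                            space_time unit_ball `[0, T[,
    continuous (fun p => u p.1 p.2)};
  mems_bounded : forall S, 0 < S < T -> exists m c, c < 1 /\
    forall x t, closed_unit_ball x -> 0 < t <= S -> m <= u x t <= c;
  mems_eq : forall x t, unit_ball x -> 0 < t < T ->
    derive1 (u x) t - laplacian (u ^~ t) x =
    lam / ((1 - u x t) ^+ 2 *
           (1 + integral_unit_ball (fun y => (1 - u y t)^-1)) ^+ 2);
  mems_boundary : forall x t, unit_sphere x -> 0 < t < T -> u x t = 0;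
  mems_initial : forall x, unit_ball x -> u x 0 = u0 x }.

Definition quenches_at (u : 'rV[R]_N -> R -> R) (Tq : R) (xs : 'rV[R]_N) :=
  exists (x_ : nat -> 'rV[R]_N) (t_ : nat -> R),
    [/\ forall k, unit_ball (x_ k) /\ 0 < t_ k < Tq,
        x_ @ \oo --> xs,
        t_ @ \oo --> Tq &
        u (x_ k) (t_ k) @[k --> \oo] --> (1 : R)].

Definition quenching_set (u : 'rV[R]_N -> R -> R) (Tq : R) : set 'rV[R]_N :=
  [set xs | closed_unit_ball xs /\ quenches_at u Tq xs].

End mems.

(* Main.v *)
(* At each time the nonlocal factor is just a positive number, so u solves
   u_t - Delta u = k(t) / (1 - u)^2 with 0 < k <= lam, whose right-hand side is
   increasing in u.  Reflect in a hyperplane {x_i = m}: on the cap that this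
   hyperplane cuts off the ball away from the origin, the difference w of the
   reflected solution and u has nonnegative boundary values and w_t - Delta w
   has the sign of w, so w >= 0.  Hence u decreases in each |x_i|.  But then
   w_t - Delta w >= 0, so w dominates the heat flow: on the spherical part of
   the cap w = u(reflection) >= c > 0 up to time Tq, and comparison with
   exp(- a |x - p|^2 / t) - const, where p = 2 e_i or -2 e_i, keeps w >= c' > 0 at
   interior points of the cap up to time Tq.  As u < 1 at the reflected point, u
   stays below 1 - c' there, and by monotonicity near every point except 0. *)
Require Import Defs.
From mathcomp Require Import all_boot all_order all_algebra.
From mathcomp Require Import all_classical all_reals all_analysis.
From mathcomp Require Import ring lra.
Import Order.TTheory GRing.Theory Num.Theory.
Import numFieldNormedType.Exports.
Local Open Scope classical_set_scope.
Local Open Scope ring_scope.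

Set Implicit Arguments.
Unset Strict Implicit.
Unset Printing Implicit Defensive.

(** * The symmetric Laplacian *)

(** The mean value theorem along the segment from [a] to [a + h] reduces the second-order remainder
    of [g] to the first-order error of [g1] at [a], times [h]. *)
Lemma taylor2 {R : realType} (g g1 : R -> R) (a c : R) :
  (\forall y \near a, is_derive (y : R) (1 : R) g (g1 y)) ->
  is_derive a (1 : R) g1 c ->
  forall e : R, 0 < e -> \forall h \near (0 : R),
    `|g (a + h) - g a - g1 a * h - c / 2 * h ^+ 2| <= e * h ^+ 2.
Proof.
move=> dg [dg1 Dg1] e e0.
have /cvgrPdist_le/(_ e e0) : (h^-1 *: (g1 (h *: 1 + a) - g1 a)) @[h --> 0^'] --> c.
  by rewrite -Dg1; exact: dg1.
rewrite /dnbhs near_withinE => /nbhs_ballP[d1 /= d10 H1].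
move/nbhs_ballP : dg => [d2 /= d20 H2].
apply/nbhs_ballP; exists (Num.min d1 d2) => /=; first by rewrite lt_min d10.
move=> h; rewrite /ball /= sub0r normrN lt_min => /andP[hd1 hd2].
(* Parametrising the segment by [k] in [[0, 1]] treats both signs of [h] at once. *)
pose phi k := g (a + k * h) - g1 a * (k * h) - c / 2 * (k * h) ^+ 2.
pose dphi k := h * (g1 (a + k * h) - g1 a - c * (k * h)).
have kh (k : R) : 0 <= k <= 1 -> `|k * h| <= `|h|.
  by move=> /andP[k0 k1]; rewrite normrM ger0_norm// ler_piMl.
have Dphi (k : R) : 0 <= k <= 1 -> is_derive k (1 : R) phi (dphi k).
  move=> k01; have Dg : is_derive (a + k * h) (1 : R) g (g1 (a + k * h)).
    apply: H2; rewrite /ball /= opprD addNKr normrN.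
    exact: le_lt_trans (kh _ k01) hd2.
  have Dl : is_derive k (1 : R) (fun k : R => a + k * h) h.
    by apply: is_derive_eq; rewrite /GRing.scale/=; ring.
  have Dc : is_derive k (1 : R) (fun k : R => g (a + k * h)) (g1 (a + k * h) * h).
    exact: (@is_derive1_comp _ g (fun k : R => a + k * h) _ _ _ Dg Dl).
  rewrite /phi; apply: is_derive_eq.
  by rewrite /dphi /GRing.scale /=; field.
have [||k + Hk] := @MVT_segment R phi dphi 0 1 ler01.
- by move=> k /[!in_itv]/= /andP[k0 k1]; apply: Dphi; rewrite !ltW.
- apply: derivable_within_continuous => k /[!in_itv]/= k01.
  by have [] := Dphi k k01.
rewrite in_itv/= => k01.
have -> : g (a + h) - g a - g1 a * h - c / 2 * h ^+ 2 = phi 1 - phi 0.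
  by rewrite /phi !mul1r !mul0r addr0; ring.
rewrite Hk subr0 mulr1 /dphi normrM -(real_normK (num_real h)).
rewrite (_ : e * _ = `|h| * (e * `|h|)); last by ring.
apply: ler_wpM2l => //.
have [kh0|kh0] := eqVneq (k * h) 0.
  by rewrite kh0 addr0 subrr mulr0 subr0 normr0 mulr_ge0// ltW.
apply: (@le_trans _ _ (e * `|k * h|)); last by rewrite ler_wpM2l ?kh// ltW.
have := H1 (k * h); rewrite /ball /= sub0r normrN.
move=> /(_ (le_lt_trans (kh _ k01) hd1) kh0).
rewrite -(ler_pM2r (_ : 0 < `|k * h|)) ?normr_gt0// -normrM.
rewrite /GRing.scale/= mulr1 (addrC _ a) -normrN; congr (`|_| <= _).
by move: kh0; rewrite mulf_eq0 negb_or => /andP[k0 h0]; field; rewrite k0 h0.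
Qed.

(** The second-order expansions at [h] and [- h] are added; the first-order terms cancel. *)
Lemma symmetric_difference2 {R : realType} (g g1 : R -> R) (c e : R) :
  (\forall y \near (0 : R), is_derive (y : R) (1 : R) g (g1 y)) ->
  is_derive (0 : R) (1 : R) g1 c -> 0 < e ->
  \forall h \near (0 : R), `|g h + g (- h) - 2 * g 0 - c * h ^+ 2| <= e * h ^+ 2.
Proof.
move=> G1 G2 e0; have e20 : 0 < e / 2 by rewrite divr_gt0.
have T := taylor2 G1 G2 e20.
have T' : \forall h \near (0 : R), `|g (0 + - h) - g 0 - g1 0 * (- h) -
    c / 2 * (- h) ^+ 2| <= e / 2 * (- h) ^+ 2.
  have := @oppr_continuous R R 0; rewrite /continuous_at oppr0 => /(_ _ T).
  exact.
move: T T'; apply: filterS2 => h; rewrite !add0r sqrrN => H H'.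
rewrite (_ : _ - _ = (g h - g 0 - g1 0 * h - c / 2 * h ^+ 2) +
    (g (- h) - g 0 - g1 0 * - h - c / 2 * h ^+ 2)); last by field.
by apply: le_trans (ler_normD _ _) _; move: H H'; lra.
Qed.

Lemma cvg_line {R : realType} {N : nat} (x d : 'rV[R]_N) (s : R) :
  x + (s * h) *: d @[h --> (0 : R)] --> x.
Proof.
suff : x + (s * h) *: d @[h --> (0 : R)] --> x + (s * 0) *: d.
  by rewrite mulr0 scale0r addr0.
have H : (fun=> x) @ nbhs (0 : R) --> x by exact: cvg_cst.
have H1 : (fun h : R => (s * h) *: d) @ nbhs (0 : R) --> (s * 0) *: d.
  apply: cvgZr_tmp; apply: cvgM; [exact: cvg_cst|exact: cvg_id].
exact: (cvgD H H1).
Qed.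

Section symmetric_laplacian.
Context {R : realType} {N : nat}.
Implicit Types (f g : 'rV[R]_N -> R) (x : 'rV[R]_N).

Definition second_difference f x (h : R) : R :=
  \sum_(i < N) (f (x + h *: delta_mx ord0 i) + f (x - h *: delta_mx ord0 i)
                - 2 * f x).

(* Unlike [laplacian], this is linear and invariant under the reflections of
   the coordinates without any differentiability hypothesis. *)
Definition symlap f x (L : R) := forall e : R, 0 < e ->
  \forall h \near (0 : R),
    `|second_difference f x h - L * h ^+ 2| <= e * h ^+ 2.

(** Where [f] touches [g] from below, the second differences are ordered for every small [h]. With
    [f] constant this is the sign of the Laplacian at a spatial minimum. *)
Lemma symlap_le f g x L M : (\forall y \near x, f y <= g y) -> f x = g x ->
  symlap f x L -> symlap g x M -> L <= M.
Proof.
move=> fg fgx fL gM; rewrite leNgt; apply/negP => ML.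
have e0 : 0 < (L - M) / 3 by rewrite divr_gt0// subr_gt0.
have fgi (s : R) : \forall h \near (0 : R), forall i : 'I_N,
    f (x + (s * h) *: delta_mx ord0 i) <= g (x + (s * h) *: delta_mx ord0 i).
  by apply: (@filter_forall R 'I_N _ (nbhs (0 : R))) => i;
     exact: (@cvg_line _ _ x (delta_mx ord0 i) s _ fg).
have := fL _ e0; have := gM _ e0; have := fgi 1; have := fgi (-1).
move=> H1 H2 H3 H4.
have [d /= d0 Hd] := (nbhs_ballP _ _).1
  (filterI (filterI H1 H2) (filterI H3 H4)).
have d20 : 0 < d / 2 by rewrite divr_gt0.
have [|[H1' H2'] [H3' H4']] := Hd (d / 2).
  by rewrite /ball/= sub0r normrN gtr0_norm//; lra.
have : second_difference f x (d / 2) <= second_difference g x (d / 2).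
  apply: ler_sum => i _; have := H1' i; have := H2' i.
  by rewrite mul1r mulN1r scaleNr fgx; lra.
move: H3' H4'; rewrite !ler_norml.
have : 0 < (d / 2) ^+ 2 by rewrite exprn_gt0.
move: (second_difference f x (d / 2)) (second_difference g x (d / 2)) => A B.
move: ((d / 2) ^+ 2) => D D0 /andP[H5 H6] /andP[H7 H8] AB.
have : 0 < (L - M) / 3 * D by rewrite mulr_gt0.
nra.
Qed.

Lemma symlapD f g x L M : symlap f x L -> symlap g x M ->
  symlap (fun y => f y + g y) x (L + M).
Proof.
move=> fL gM e e0; have e20 : 0 < e / 2 by rewrite divr_gt0.
have := fL _ e20; have := gM _ e20; apply: filterS2 => h H1 H2.
have -> : second_difference (fun y => f y + g y) x h =
    second_difference f x h + second_difference g x h.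
  by rewrite -big_split; apply: eq_bigr => i _ /=; ring.
rewrite (_ : _ - _ = second_difference f x h - L * h ^+ 2 +
    (second_difference g x h - M * h ^+ 2)); last by ring.
by apply: le_trans (ler_normD _ _) _; move: H1 H2; lra.
Qed.

Lemma symlapZ f x k L : symlap f x L -> symlap (fun y => k * f y) x (k * L).
Proof.
(* The [+ 1] keeps the divisor positive when [k = 0]. *)
move=> fL e e0; have k0 : 0 < `|k| + 1 by rewrite ltr_wpDl.
have := fL _ (divr_gt0 e0 k0); apply: filterS => h H.
have -> : second_difference (fun y => k * f y) x h = k * second_difference f x h.
  by rewrite /second_difference big_distrr; apply: eq_bigr => i _ /=; ring.
rewrite -mulrA -mulrBr normrM.
apply: (@le_trans _ _ ((`|k| + 1) * (e / (`|k| + 1) * h ^+ 2))).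
  by rewrite ler_pM// lerDl.
rewrite (_ : _ * (_ / _ * _) = e * h ^+ 2)//.
by field; rewrite gt_eqF.
Qed.

Lemma symlapB f g x L M :
  symlap f x L -> symlap g x M -> symlap (fun y => f y - g y) x (L - M).
Proof.
move=> fL /(symlapZ (-1)); rewrite mulN1r => gM.
rewrite (_ : (fun y => f y - g y) = (fun y => f y + -1 * g y)).
  exact: symlapD.
by apply/funext => y; rewrite mulN1r.
Qed.

Lemma symlap_cst (c : R) x : symlap (fun=> c) x 0.
Proof.
move=> e e0; apply: (@filterE _ (nbhs (0 : R))) => h.
rewrite /second_difference big1 => [|i _].
  by rewrite mul0r subrr normr0 mulr_ge0 ?sqr_ge0// ltW.
by rewrite /=; ring.
Qed.

(** The expansion is checked one axis at a time, each with tolerance [e / (N%:R + 1)], where the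
    [+ 1] allows for [N = 0]. *)
Lemma symlap_sum (F : 'I_N -> R -> R) f x (L : 'I_N -> R) :
  (forall i h, f (x + h *: delta_mx ord0 i) = F i h) ->
  (forall i (e : R), 0 < e -> \forall h \near (0 : R),
     `|F i h + F i (- h) - 2 * F i 0 - L i * h ^+ 2| <= e * h ^+ 2) ->
  symlap f x (\sum_(i < N) L i).
Proof.
move=> fF FL e e0; have N0 : 0 < N%:R + 1 :> R by rewrite ltr_wpDl.
have : \forall h \near (0 : R), forall i,
    `|F i h + F i (- h) - 2 * F i 0 - L i * h ^+ 2| <= e / (N%:R + 1) * h ^+ 2.
  by apply: (@filter_forall R 'I_N _ (nbhs (0 : R))) => i; apply: FL; rewrite divr_gt0.
apply: filterS => h H; rewrite /second_difference mulr_suml -sumrB.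
apply: le_trans (ler_norm_sum _ _ _) _.
apply: (@le_trans _ _ (\sum_(i < N) e / (N%:R + 1) * h ^+ 2)).
  apply: ler_sum => i _; apply: le_trans (H i).
  by rewrite -scaleNr !fF -(fF i 0) scale0r addr0.
rewrite sumr_const card_ord -[leLHS]mulr_natl.
rewrite (_ : N%:R * _ = N%:R / (N%:R + 1) * (e * h ^+ 2)); last first.
  by field; rewrite gt_eqF.
apply: ler_piMl; first by rewrite mulr_ge0 ?sqr_ge0// ltW.
by rewrite ler_pdivrMr// mul1r lerDl.
Qed.

(** Each axis is a one-dimensional problem for [g i]; this is how classical solutions enter the
    comparison arguments. *)
Lemma laplacian_symlap f x :
  (forall i, \forall y \near x, derivable f y (delta_mx ord0 i)) ->
  (forall i, derivable (partial i f) x (delta_mx ord0 i)) ->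
  symlap f x (laplacian f x).
Proof.
move=> d1 d2.
pose g i (h : R) := f (x + h *: delta_mx ord0 i).
pose g1 i (h : R) := partial i f (x + h *: delta_mx ord0 i).
apply: (@symlap_sum g _ _ (fun i => partial i (partial i f) x)) => // i e e0.
have line (w : 'rV[R]_N -> R) (h : R) :
    derivable w (x + h *: delta_mx ord0 i) (delta_mx ord0 i) ->
    is_derive (h : R) (1 : R) (fun h : R => w (x + h *: delta_mx ord0 i))
      (partial i w (x + h *: delta_mx ord0 i)).
  have E : (fun k : R => k^-1 *: (((fun h : R => w (x + h *: delta_mx ord0 i)) \o
        shift h) (k *: (1 : R)) - w (x + h *: delta_mx ord0 i))) =
      (fun k : R => k^-1 *: ((w \o shift (x + h *: delta_mx ord0 i))
        (k *: delta_mx ord0 i) - w (x + h *: delta_mx ord0 i))).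
    apply/funext => k /=; congr (_ *: (w _ - _)).
    by rewrite [k%:A]mulr1 scalerDl addrCA.
  by move=> dw; split; rewrite /partial /derivable /derive E.
have G1 : \forall h \near (0 : R), is_derive (h : R) (1 : R) (g i) (g1 i h).
  have := @cvg_line _ _ x (delta_mx ord0 i) 1 _ (d1 i).
  move=> H; apply: (@filterS _ (nbhs (0 : R)) _ _ _ _ H) => h.
  by rewrite /= mul1r; exact: line.
have G2 : is_derive (0 : R) (1 : R) (g1 i) (partial i (partial i f) x).
  by have := line (partial i f) 0; rewrite scale0r addr0; apply.
exact: (symmetric_difference2 G1 G2 e0).
Qed.

(** The squared Euclidean distance is a polynomial in the coordinates, hence smooth even at [p]. *)
Definition sqdist (p x : 'rV[R]_N) : R := \sum_(i < N) (x ord0 i - p ord0 i) ^+ 2.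

Lemma sqdist_line p x i h : sqdist p (x + h *: delta_mx ord0 i) =
  sqdist p x + (2 * (x ord0 i - p ord0 i) * h + h ^+ 2).
Proof.
rewrite /sqdist (bigD1 i)//= [in RHS](bigD1 i)//= !mxE !eqxx mulr1.
rewrite [X in _ + X = _](_ : _ = \sum_(j < N | j != i) (x ord0 j - p ord0 j) ^+ 2).
  by ring.
by apply: eq_bigr => j ji; rewrite !mxE (negbTE ji) andbF mulr0 addr0.
Qed.

(** This is Delta F(q) = F''(q) |grad q|^2 + F'(q) Delta q for q = |x - p|^2, where |grad q|^2 = 4 q
    and Delta q = 2 N. *)
Lemma symlap_radial (F F1 : R -> R) (p x : 'rV[R]_N) (c : R) :
  (\forall r \near sqdist p x, is_derive (r : R) (1 : R) F (F1 r)) ->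
  is_derive (sqdist p x) (1 : R) F1 c ->
  symlap (fun y => F (sqdist p y)) x (4 * sqdist p x * c + 2 * N%:R * F1 (sqdist p x)).
Proof.
set r := sqdist p x => DF DF1.
pose b i := x ord0 i - p ord0 i.
rewrite (_ : _ + _ = \sum_(i < N) (4 * b i ^+ 2 * c + 2 * F1 r)); last first.
  rewrite big_split /= -mulr_suml -mulr_sumr (_ : \sum_i b i ^+ 2 = r)//.
  by rewrite sumr_const card_ord -(mulr_natl (2 * F1 r) N); ring.
pose q i (h : R) := r + (2 * b i * h + h ^+ 2).
have Dq i (h : R) : is_derive h (1 : R) (q i) (2 * b i + 2 * h).
  by rewrite /q; apply: is_derive_eq; rewrite /GRing.scale /=; ring.
have q0 i : q i 0 = r by rewrite /q mulr0 expr0n/= !addr0.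
apply: (@symlap_sum (fun i h => F (q i h))) => [i h|i e e0].
  by rewrite sqdist_line.
pose g1 h := F1 (q i h) * (2 * b i + 2 * h).
apply: (@symmetric_difference2 _ (fun h => F (q i h)) g1) => //.
  have : q i h @[h --> (0 : R)] --> q i 0.
    apply: (@differentiable_continuous _ _ _ (0 : R) (q i)).
    by apply/derivable1_diffP; have [] := Dq i 0.
  rewrite q0 => /(_ _ DF) H; apply: (@filterS _ (nbhs (0 : R)) _ _ _ _ H) => h /= Dh.
  exact: (@is_derive1_comp _ F (q i) _ _ _ Dh (Dq i h)).
have DF1q : is_derive (0 : R) (1 : R) (fun h => F1 (q i h)) (c * (2 * b i + 2 * 0)).
  by apply: (@is_derive1_comp _ F1 (q i)); rewrite q0.
by apply: is_derive_eq; rewrite q0 /GRing.scale /=; ring.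
Qed.

End symmetric_laplacian.

(** * Parabolic comparison *)

(** Only times before [t] are compared, because the minimum in a parabolic comparison may sit at the
    final time. *)
Lemma left_min_derive_le0 {R : realType} (g : R -> R) (t d : R) :
  is_derive t (1 : R) g d -> (\forall s \near t, s < t -> g t <= g s) -> d <= 0.
Proof.
move=> [dg Dg] gmin; rewrite leNgt; apply/negP => d0.
have d20 : 0 < d / 2 by rewrite divr_gt0.
have /cvgrPdist_le/(_ _ d20) : (h^-1 *: (g (h *: 1 + t) - g t)) @[h --> 0^'] --> d.
  by rewrite -Dg; exact: dg.
rewrite /dnbhs near_withinE => /nbhs_ballP[d1 /= d10 H1].
move/nbhs_ballP : gmin => [d2 /= d20' H2].
pose h := - (Num.min d1 d2 / 2).
have m0 : 0 < Num.min d1 d2 by rewrite lt_min d10.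
have m1 : Num.min d1 d2 <= d1 by rewrite ge_min lexx.
have m2 : Num.min d1 d2 <= d2 by rewrite ge_min lexx orbT.
have h0 : h < 0 by rewrite /h oppr_lt0 divr_gt0.
have nh : `|h| = Num.min d1 d2 / 2 by rewrite normrN gtr0_norm// divr_gt0.
have := H1 h; rewrite /ball /= sub0r normrN nh => /(_ _ _) H.
have {H} : `|d - h^-1 *: (g (h%:A + t) - g t)| <= d / 2 by apply: H; [lra|rewrite lt_eqF].
have : g t <= g (h + t).
  apply: H2; last lra.
  by rewrite /ball/= opprD addrCA subrr addr0 normrN nh; lra.
rewrite [h%:A]mulr1 => gg.
have : h^-1 *: (g (h + t) - g t) <= 0.
  by rewrite /GRing.scale/= mulr_le0_ge0 ?subr_ge0// invr_le0 ltW.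
rewrite ler_norml => ? /andP[_]; lra.
Qed.

(* Only a neighbourhood of the points where [V] is negative matters: it is
   controlled through a compact set [P] which contains all of them. *)
Lemma parabolic_comparison {R : realType} {N : nat} (Om : set 'rV[R]_N)
    (P : set ('rV[R]_N * R)) (t0 S K : R) (V : 'rV[R]_N -> R -> R) :
  compact P -> {within P, continuous (fun p => V p.1 p.2)} ->
  (forall x (t : R), Om x -> t0 < t <= S -> V x t < 0 -> P (x, t)) ->
  (forall x t, P (x, t) -> V x t < 0 -> [/\ t0 < t <= S, nbhs x Om &
    exists d L, [/\ is_derive t (1 : R) (V x) d, symlap (V ^~ t) x L &
      K * V x t <= d - L]]) ->
  forall x (t : R), Om x -> t0 < t <= S -> 0 <= V x t.
Proof.
move=> cP cV negP' Vsuper x t Omx tS; rewrite leNgt; apply/negP => Vneg.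
(* The weight shifts the zero-order coefficient: at a negative minimum of [W], [d <= (K + 1) * V]
   and [0 <= L], so [K * V <= d - L] would force [0 <= V]. *)
pose W (p : 'rV[R]_N * R) := expR (- ((K + 1) * p.2)) * V p.1 p.2.
have cW : {within P, continuous W}.
  apply/subspace_continuousP => p Pp; apply: cvgM; last first.
    by move/subspace_continuousP : cV; exact.
  apply: cvg_within_filter; apply: continuous_comp; last exact: continuous_expR.
  apply: cvgN; apply: cvgM; [exact: cvg_cst|exact: cvg_snd].
have Pxt : P (x, t) by exact: negP'.
have [|[y s] /set_mem Pys Wmin] := compact_EVT_min _ cP cW.
  by exists (x, t).
have Wneg : W (y, s) < 0.
  apply: (@le_lt_trans _ _ (W (x, t))); first by apply: Wmin; exact: mem_set.
  by rewrite /W /= pmulr_rlt0// expR_gt0.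
have Vys : V y s < 0 by move: Wneg; rewrite /W /= pmulr_rlt0// expR_gt0.
have [sS Omy [d [L [Dd Ls VKs]]]] := Vsuper _ _ Pys Vys.
(* Minimality over [P] extends to all of [Om] at the times in question, since [V] is nonnegative
   there off [P]. *)
have {}Wmin z r : Om z -> t0 < r <= S -> W (y, s) <= W (z, r).
  move=> Omz rS; have [Vzr|Vzr] := leP 0 (V z r).
    by apply: (le_trans (ltW Wneg)); rewrite mulr_ge0// expR_ge0.
  by apply: Wmin; apply/mem_set; exact: negP'.
have L0 : 0 <= L.
  apply: (symlap_le _ _ (symlap_cst (V y s) y) Ls) => //.
  move: Omy; apply: filterS => z Omz; have := Wmin z s Omz sS.
  by rewrite /W /= ler_pM2l// expR_gt0.
have D : is_derive s (1 : R) (fun r => W (y, r))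
    (expR (- ((K + 1) * s)) * (d - (K + 1) * V y s)).
  have De : is_derive s (1 : R) (fun r : R => expR (- ((K + 1) * r)))
      (expR (- ((K + 1) * s)) * - (K + 1)).
    apply: (@is_derive1_comp _ expR (fun r : R => - ((K + 1) * r))).
    by apply: is_derive_eq; rewrite /GRing.scale /=; ring.
  by rewrite /W /=; apply: is_derive_eq; rewrite /GRing.scale /=; ring.
have : expR (- ((K + 1) * s)) * (d - (K + 1) * V y s) <= 0.
  apply: (left_min_derive_le0 D).
  have /andP[ts sS'] := sS.
  apply: filterS (lt_nbhsr ts) => r tr rs.
  apply: Wmin; first exact: nbhs_singleton.
  by rewrite tr (le_trans (ltW rs)).
rewrite pmulr_rle0 ?expR_gt0//; nra.
Qed.

(** * A barrier for the corner (unit sphere) x {0} *)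

Section euclidean_ball.
Context {R : realType} {N : nat}.
Implicit Types (p x : 'rV[R]_N).

Lemma sqdist_ge0 p x : 0 <= sqdist p x.
Proof. by apply: sumr_ge0 => i _; rewrite sqr_ge0. Qed.

Lemma sqdist_ge_coord p x i : (x ord0 i - p ord0 i) ^+ 2 <= sqdist p x.
Proof.
by rewrite /sqdist (bigD1 i)//= lerDl; apply: sumr_ge0 => j _; rewrite sqr_ge0.
Qed.

Lemma enormE x : enorm x = Num.sqrt (sqdist 0 x).
Proof. by congr Num.sqrt; apply: eq_bigr => i _; rewrite mxE subr0. Qed.

Lemma unit_ballE x : unit_ball x = (sqdist 0 x < 1) :> Prop.
Proof.
rewrite /unit_ball /= enormE; congr (is_true _).
by rewrite -[X in _ < X]sqrtr1 ltr_sqrt.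
Qed.

Lemma closed_unit_ballE x : closed_unit_ball x = (sqdist 0 x <= 1) :> Prop.
Proof.
rewrite /closed_unit_ball /= enormE; congr (is_true _).
by rewrite -[X in _ <= X]sqrtr1 ler_sqrt.
Qed.

Lemma unit_sphereE x : unit_sphere x <-> sqdist 0 x = 1.
Proof.
rewrite /unit_sphere /= enormE; split => [h|->]; last exact: sqrtr1.
by rewrite -(sqr_sqrtr (sqdist_ge0 0 x)) h expr1n.
Qed.

Lemma continuous_sqdist p : continuous (sqdist p).
Proof.
move=> x; apply: (@cvg_big _ _ _ _ _ add_continuous _ (nbhs x) _
  (fun i (y : 'rV[R]_N) => (y ord0 i - p ord0 i) ^+ 2)) => i _.
apply: (@cvg_comp _ _ _ (fun y : 'rV[R]_N => y ord0 i - p ord0 i)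
  (fun z : R => z ^+ 2)); last exact: exprn_continuous.
have H : (fun y : 'rV[R]_N => y ord0 i) @ nbhs x --> x ord0 i.
  exact: coord_continuous.
have H' : (fun=> p ord0 i) @ nbhs x --> p ord0 i by exact: cvg_cst.
exact: (cvgB H H').
Qed.

Lemma compact_closed_unit_ball : compact (@closed_unit_ball R N).
Proof.
rewrite (_ : @closed_unit_ball R N = [set x | sqdist 0 x <= 1]); last first.
  by apply/seteqP; split=> x /=; rewrite closed_unit_ballE.
apply: bounded_closed_compact.
  exists 1; split; first exact: num_real.
  move=> M M1 x /= xB; apply: (@le_trans _ _ 1); last exact: ltW.
  rewrite /Num.norm /= mx_normrE; apply: bigmax_le => // -[i j] _ /=.
  have := sqdist_ge_coord 0 x j; rewrite mxE subr0 (ord1 i) => h.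
  by rewrite -(@ler_pXn2r _ 2)// ?nnegrE// expr1n real_normK ?num_real// (le_trans h).
have H : closed (sqdist (0 : 'rV[R]_N) @^-1` [set y | y <= 1]).
  by apply: preimage_closed => [x _|]; [exact: continuous_sqdist|exact: closed_le].
exact: H.
Qed.

End euclidean_ball.

(* The factor [(tau / (t + tau)) ^ (1/4)] makes the barrier vanish pointwise as
   [tau] tends to 0; near the sphere the exponent 1/4 < 1/2 leaves a positive
   term [1 / (4 (t + tau))] in the heat operator, and away from the sphere the
   factor [expR (k * t)] absorbs what remains. *)
Definition barrier_exponent {R : realType} (k tau t r : R) : R :=
  k * t + (ln tau - ln (t + tau)) / 4 - (1 - r) ^+ 2 / (16 * (t + tau)).

Section barrier.
Context {R : realType} {N : nat} (k tau : R).
Hypothesis tau_gt0 : 0 < tau.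
Implicit Types (x : 'rV[R]_N) (t : R).

Definition barrier x t : R := expR (barrier_exponent k tau t (sqdist 0 x)).

Lemma is_derive_barrier x t : 0 <= t ->
  is_derive t (1 : R) (barrier x) (barrier x t *
    (k - (4 * (t + tau))^-1 + (1 - sqdist 0 x) ^+ 2 / (16 * (t + tau) ^+ 2))).
Proof.
move=> t0; have s0 : 0 < t + tau by rewrite ltr_wpDl.
apply: (@is_derive1_comp _ expR (fun t => barrier_exponent k tau t (sqdist 0 x))).
have Dln : is_derive t (1 : R) (fun t => ln (t + tau)) (t + tau)^-1.
  rewrite -[X in is_derive _ _ _ X]mulr1.
  apply: (@is_derive1_comp _ (@ln R) (fun t => t + tau)); first exact: is_derive1_ln.
  by apply: is_derive_eq; rewrite addr0.
have Dinv : is_derive t (1 : R) (fun t => (16 * (t + tau))^-1)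
    (- (16 * (t + tau)) ^- 2 * 16).
  apply: is_derive_eq; first by apply: is_deriveV; rewrite mulf_neq0// gt_eqF.
  by rewrite /GRing.scale /=; field; rewrite gt_eqF.
rewrite /barrier_exponent; apply: is_derive_eq.
by rewrite /GRing.scale /=; field; rewrite gt_eqF.
Qed.

Lemma symlap_barrier x t : 0 <= t -> symlap (barrier ^~ t) x
  (let s := t + tau in let r := sqdist 0 x in barrier x t *
   (r * (1 - r) ^+ 2 / (16 * s ^+ 2) - r / (2 * s) + N%:R * (1 - r) / (4 * s))).
Proof.
move=> t0; cbv zeta; set s := t + tau; set r := sqdist 0 x.
have s0 : 0 < s by rewrite /s ltr_wpDl.
pose F (y : R) := expR (barrier_exponent k tau t y).
have DF y : is_derive (y : R) (1 : R) F (F y * ((1 - y) / (8 * s))).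
  apply: (@is_derive1_comp _ expR (barrier_exponent k tau t)).
  rewrite /barrier_exponent -/s; apply: is_derive_eq.
  by rewrite /GRing.scale /=; field; rewrite gt_eqF.
rewrite (_ : barrier x t * _ = 4 * r *
    (F r * (((1 - r) / (8 * s)) ^+ 2 - (8 * s)^-1)) +
    2 * N%:R * (F r * ((1 - r) / (8 * s)))); last first.
  by rewrite /F /barrier; field; rewrite gt_eqF.
apply: (@symlap_radial _ _ F (fun y => F y * ((1 - y) / (8 * s)))).
  exact: filterE.
have DFr := DF r.
by apply: is_derive_eq; rewrite -/r /GRing.scale /=; field; rewrite gt_eqF.
Qed.

(** Division by the barrier leaves q^3 y^2 / 16 + (1/4 - c q) y + 16 c^3 >= 0, with q = 1 - r, y = 1
    / s and c = 1/2 + N/4. This is clear for 4 c q <= 1. Otherwise q times the left side is a square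
    plus q y / 4 plus 16 c^3 q - 4 c^2, and the constant 16 c^3 makes the last difference
    nonnegative. *)
Lemma barrier_super (K t : R) x : 0 <= t -> sqdist 0 x <= 1 ->
  k = K + 16 * (2^-1 + N%:R / 4) ^+ 3 ->
  let s := t + tau in let r := sqdist 0 x in
  K * barrier x t <= barrier x t *
    (k - (4 * s)^-1 + (1 - r) ^+ 2 / (16 * s ^+ 2)) - barrier x t *
   (r * (1 - r) ^+ 2 / (16 * s ^+ 2) - r / (2 * s) + N%:R * (1 - r) / (4 * s)).
Proof.
move=> t0 r1 ->; cbv zeta; set s := t + tau; set r := sqdist 0 x.
have s0 : 0 < s by rewrite /s ltr_wpDl.
rewrite -mulrBr mulrC ler_pM2l ?expR_gt0//.
set c := 2^-1 + N%:R / 4.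
have c0 : 0 < c by rewrite /c ltr_pwDl// divr_ge0.
pose q := 1 - r; pose y := s^-1; have y0 : 0 < y by rewrite /y invr_gt0.
rewrite -subr_ge0 (_ : _ - K = q ^+ 3 * y ^+ 2 / 16 + (4^-1 - c * q) * y + 16 * c ^+ 3);
  last by rewrite /c /q /y; field; rewrite gt_eqF.
have q0 : 0 <= q by rewrite /q subr_ge0.
have [cq|cq] := leP (4 * (c * q)) 1.
  have h1 : 0 <= q ^+ 3 * y ^+ 2 / 16.
    by rewrite divr_ge0// mulr_ge0// exprn_ge0// ltW.
  have h2 : 0 <= (4^-1 - c * q) * y by rewrite mulr_ge0 ?(ltW y0)//; lra.
  have h3 : 0 <= 16 * c ^+ 3 by rewrite mulr_ge0// exprn_ge0// ltW.
  lra.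
have {}q0 : 0 < q by rewrite -(pmulr_rgt0 _ c0); lra.
have c2 : 4 * c ^+ 2 <= 16 * c ^+ 3 * q.
  have := exprn_gt0 2 c0; move: cq; rewrite (exprS c 2); move: (c ^+ 2) => C.
  by rewrite (_ : 16 * (c * C) * q = 4 * C * (4 * (c * q))); [nra|ring].
rewrite -(pmulr_rge0 _ q0).
rewrite (_ : q * _ = (q ^+ 2 * y / 4 - 2 * c) ^+ 2 + q * y / 4 +
    (16 * c ^+ 3 * q - 4 * c ^+ 2)); last by field.
have h1 : 0 <= q * y / 4 by rewrite divr_ge0// mulr_ge0// ltW.
have h2 := sqr_ge0 (q ^+ 2 * y / 4 - 2 * c).
lra.
Qed.

(** This near the corner the logarithms cost the exponent at most 1/4 and the quadratic term at most
    1/16. *)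
Lemma barrier_corner x t : 0 <= k -> 0 <= t -> (1 - sqdist 0 x) ^+ 2 + t < tau ->
  expR (- 1) <= barrier x t.
Proof.
move=> k0 t0 H; have s0 : 0 < t + tau by rewrite ltr_wpDl.
have q0 := sqr_ge0 (1 - sqdist 0 x).
rewrite ler_expR /barrier_exponent.
have : ln (t + tau) - ln tau <= 1.
  rewrite -ln_div ?posrE//.
  have -> : (t + tau) / tau = 1 + t / tau by field; rewrite gt_eqF.
  have tt : 0 <= t / tau by rewrite divr_ge0// ltW.
  apply: (le_trans (le_ln1Dx _)); first by lra.
  by rewrite ler_pdivrMr//; lra.
have : (1 - sqdist 0 x) ^+ 2 / (16 * (t + tau)) <= 16^-1.
  by rewrite ler_pdivrMr ?mulr_gt0//; lra.
have := mulr_ge0 k0 t0; lra.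
Qed.

End barrier.

(** [tau] solves [k * t + (ln tau - ln t) / 4 = ln e]; replacing [ln t] by [ln (t + tau)] and
    subtracting the quadratic term only lower the exponent. *)
Lemma barrier_small {R : realType} {N : nat} (k t e : R) (x : 'rV[R]_N) :
  0 < t -> 0 < e -> exists2 tau, 0 < tau & barrier k tau x t <= e.
Proof.
move=> t0 e0; pose tau := t * expR (4 * (ln e - k * t)).
have tau0 : 0 < tau by rewrite mulr_gt0// expR_gt0.
exists tau => //; rewrite -[leRHS]lnK ?posrE// ler_expR /barrier_exponent.
have : ln tau = ln t + 4 * (ln e - k * t).
  by rewrite lnM ?posrE ?expR_gt0// expRK.
have : ln t <= ln (t + tau) by rewrite ler_ln ?posrE ?lerDl ?(ltW tau0)// addr_gt0.
have : 0 <= (1 - sqdist 0 x) ^+ 2 / (16 * (t + tau)).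
  by rewrite divr_ge0 ?sqr_ge0// mulr_ge0// ltW// addr_gt0.
lra.
Qed.

Lemma continuous_barrier {R : realType} {N : nat} (k tau : R) (p : 'rV[R]_N * R) :
  0 < tau -> 0 <= p.2 -> barrier k tau p.1 p.2 @[p --> p] --> barrier k tau p.1 p.2.
Proof.
move=> tau0 p0; have s0 : 0 < p.2 + tau by rewrite ltr_wpDl.
have ct : q.2 @[q --> p] --> p.2 by exact: cvg_snd.
have cs : q.2 + tau @[q --> p] --> p.2 + tau by apply: cvgD ct (cvg_cst _).
have cr : sqdist 0 q.1 @[q --> p] --> sqdist 0 p.1.
  by apply: (cvg_comp _ _ cvg_fst); exact: continuous_sqdist.
apply: (@cvg_comp _ _ _ (fun q : 'rV[R]_N * R =>
  barrier_exponent k tau q.2 (sqdist 0 q.1)) expR); last exact: continuous_expR.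
apply: cvgB; first apply: cvgD.
- by apply: cvgM ct; exact: cvg_cst.
- apply: cvgM; last exact: cvg_cst.
  apply: cvgB; first exact: cvg_cst.
  by apply: (cvg_comp _ _ cs); exact: continuous_ln.
- apply: cvgM.
    apply: (@cvg_comp _ _ _ (fun q : 'rV[R]_N * R => 1 - sqdist 0 q.1)
      (fun z : R => z ^+ 2)); last exact: exprn_continuous.
    by apply: cvgB cr; exact: cvg_cst.
  apply: cvgV; first by rewrite mulf_neq0// gt_eqF.
  by apply: cvgM cs; exact: cvg_cst.
Qed.

(* [V] need not be continuous at the corner (unit sphere) x {0}. *)
Lemma corner_comparison {R : realType} {N : nat} (Om : set 'rV[R]_N) (S K M : R)
    (V : 'rV[R]_N -> R -> R) :
  closed Om -> Om `<=` @closed_unit_ball R N -> 0 <= K -> 0 <= M ->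
  {within [set p | [/\ Om p.1, 0 <= p.2 <= S & p.2 = 0 -> unit_ball p.1]],
    continuous (fun p => V p.1 p.2)} ->
  (forall x (t : R), Om x -> 0 < t <= S -> - M <= V x t) ->
  (forall x, Om x -> unit_ball x -> 0 <= V x 0) ->
  (forall x (t : R), Om x -> 0 < t <= S -> V x t < 0 -> nbhs x Om /\
    exists d L, [/\ is_derive t (1 : R) (V x) d, symlap (V ^~ t) x L &
      K * V x t <= d - L]) ->
  forall x (t : R), Om x -> 0 < t <= S -> 0 <= V x t.
Proof.
move=> clOm OmB K0 M0 cV VM V0 Vsuper x t Omx tS.
pose k := K + 16 * (2^-1 + N%:R / 4) ^+ 3.
have Kk : K <= k.
  by rewrite /k lerDl mulr_ge0// exprn_ge0// addr_ge0// divr_ge0.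
have k0 : 0 <= k := le_trans K0 Kk.
have r1 y : Om y -> sqdist 0 y <= 1 by move/OmB; rewrite closed_unit_ballE.
(* Two perturbations are added and then removed: [tau] makes the barrier term at most [e / 2], and
   [del] makes the other one equal to [e / 2]. *)
suff main (del tau : R) : 0 < del -> 0 < tau ->
    0 <= V x t + (del * expR (k * t) + M * expR 1 * barrier k tau x t).
  apply/ler_addgt0Pl => e e0.
  have /andP[t0 _] := tS.
  have M1 : 0 < M * expR 1 + 1 by rewrite ltr_wpDl// mulr_ge0// expR_ge0.
  have [|tau tau0 Hb] := @barrier_small R N k t (e / 2 / (M * expR 1 + 1)) x t0.
    by rewrite !divr_gt0.
  have d0 : 0 < e / 2 / expR (k * t) by rewrite !divr_gt0// expR_gt0.
  apply: (le_trans (main _ _ d0 tau0)); rewrite addrC lerD2r.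
  rewrite divfK ?gt_eqF ?expR_gt0//.
  have : M * expR 1 * barrier k tau x t <= e / 2.
    move: Hb; rewrite ler_pdivlMr// mulrDr mulr1 mulrC.
    have : 0 <= barrier k tau x t by exact: expR_ge0.
    lra.
  lra.
move=> del0 tau0.
pose W y s := V y s + (del * expR (k * s) + M * expR 1 * barrier k tau y s).
(* [P] leaves out a neighbourhood of the corner, so that it is compact and [V] is continuous on
   it. *)
pose P := [set p : 'rV[R]_N * R |
  [/\ Om p.1, 0 <= p.2 <= S & tau <= (1 - sqdist 0 p.1) ^+ 2 + p.2]].
(* Where [W] is negative, so is [V], and the differential inequality for [V] is available. *)
have VW y s : V y s < W y s.
  rewrite /W ltrDl ltr_pwDl ?mulr_gt0 ?expR_gt0//.
  by rewrite !mulr_ge0 ?expR_ge0.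
have Pball y s : P (y, s) -> s = 0 -> unit_ball y.
  move=> [/= Omy _ H] s0; rewrite unit_ballE lt_neqAle r1// andbT.
  by apply: contraTneq H => ->; rewrite s0 subrr expr0n/= addr0 -ltNge.
have cP : compact P.
  have cB : compact (@closed_unit_ball R N `*` `[0, S]).
    by apply: compact_setX; [exact: compact_closed_unit_ball|exact: segment_compact].
  apply: (subclosed_compact _ cB); last first.
    by move=> [y s] [/= /OmB ? ? _]; split=> //=; rewrite in_itv.
  have cl1 : closed ((fun p : 'rV[R]_N * R => p.1) @^-1` Om).
    by apply: preimage_closed => // p _; exact: cvg_fst.
  have cl2 : closed ((fun p : 'rV[R]_N * R => p.2) @^-1` `[0, S]).
    by apply: preimage_closed => [p _|]; [exact: cvg_snd|exact: itv_closed].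
  have cl3 : closed ((fun p : 'rV[R]_N * R => (1 - sqdist 0 p.1) ^+ 2 + p.2) @^-1`
      [set z | tau <= z]).
    apply: preimage_closed => [p _|]; last exact: closed_ge.
    apply: cvgD; last exact: cvg_snd.
    apply: (@cvg_comp _ _ _ (fun q : 'rV[R]_N * R => 1 - sqdist 0 q.1)
      (fun z : R => z ^+ 2)); last exact: exprn_continuous.
    apply: cvgB; first exact: cvg_cst.
    by apply: (cvg_comp _ _ cvg_fst); exact: continuous_sqdist.
  have := closedI (closedI cl1 cl2) cl3; congr closed.
  apply/seteqP; split => -[y s] /=; rewrite in_itv/=.
    by move=> [[]].
  by move=> [].
(* Near the corner the barrier is at least [expR (- 1)], so the factor [M * expR 1] makes up for the
   bound [- M] on [V], and [W] cannot be negative. *)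
have Wneg y s : Om y -> 0 < s <= S -> W y s < 0 -> tau <= (1 - sqdist 0 y) ^+ 2 + s.
  move=> Omy sS; rewrite leNgt; apply: contraTN => H; rewrite -leNgt.
  have /andP[s0 _] := sS.
  have Hb := barrier_corner tau0 k0 (ltW s0) H.
  have : M <= M * expR 1 * barrier k tau y s.
    rewrite -mulrA ler_peMr//; apply: le_trans (ler_wpM2l (expR_ge0 1) Hb).
    by rewrite -expRD subrr expR0.
  have := VM _ _ Omy sS; have := mulr_ge0 (ltW del0) (expR_ge0 (k * s)).
  by rewrite /W; lra.
apply: (@parabolic_comparison _ _ Om P 0 S K W) => //.
- apply/subspace_continuousP => p Pp; apply: cvgD.
    have PD : P `<=` [set p | [/\ Om p.1, 0 <= p.2 <= S & p.2 = 0 -> unit_ball p.1]].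
      by move=> [y s] Pys; have [? ? _] := Pys; split => //; exact: Pball Pys.
    by have /subspace_continuousP := continuous_subspaceW PD cV; exact.
  apply: cvg_within_filter; apply: cvgD.
    apply: cvgM; first exact: cvg_cst.
    apply: (@cvg_comp _ _ _ (fun q : 'rV[R]_N * R => k * q.2) expR).
      by apply: cvgM; [exact: cvg_cst|exact: cvg_snd].
    exact: continuous_expR.
  apply: cvgM; first exact: cvg_cst.
  by apply: continuous_barrier => //; have [_ /andP[]] := Pp.
- move=> y s Omy sS Wys; split=> //=; last exact: Wneg.
  by have /andP[/ltW -> ->] := sS.
- move=> y s Pys Wys; have [/= Omy /andP[s0 sS] _] := Pys.
  have Vys := lt_trans (VW y s) Wys.
  have {}s0 : 0 < s.
    rewrite lt_neqAle s0 andbT; apply: contraTneq Vys => s00.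
    rewrite -leNgt -s00; apply: V0 => //; exact: (Pball _ _ Pys).
  have [|nOmy [d [L [Vd VL KV]]]] := Vsuper _ _ Omy _ Vys; first by rewrite s0.
  split=> //; first by rewrite s0.
  have Db := is_derive_barrier k tau0 y (ltW s0).
  have Lb := symlap_barrier k tau0 y (ltW s0).
  have := barrier_super tau0 (ltW s0) (r1 _ Omy) (erefl k).
  move: Db Lb; cbv zeta; set db := barrier _ _ _ _ * (k - _ + _).
  set Lb := _ * (_ - _ + _) => Dbar Lbar Hbar.
  have De : is_derive s (1 : R) (fun s : R => expR (k * s)) (expR (k * s) * k).
    apply: (@is_derive1_comp _ expR (fun s : R => k * s)).
    by apply: is_derive_eq; rewrite /GRing.scale /=; ring.
  exists (d + (del * (expR (k * s) * k) + M * expR 1 * db)).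
  exists (L + (0 + M * expR 1 * Lb)); split.
  + by rewrite /W; apply: is_derive_eq; rewrite /GRing.scale /=; ring.
  + apply: symlapD => //; apply: symlapD; first exact: symlap_cst.
    exact: symlapZ.
  (* Both perturbations are supersolutions: the exponential because [K <= k], the barrier by
     [barrier_super]. *)
  + have h1 : K * (del * expR (k * s)) <= del * (expR (k * s) * k).
      by rewrite mulrA (mulrC K) -mulrA ler_pM2l// mulrC ler_pM2l ?expR_gt0.
    have h2 : M * expR 1 * (K * barrier k tau y s) <= M * expR 1 * (db - Lb).
      by rewrite ler_wpM2l// mulr_ge0// expR_ge0.
    rewrite /W; move: (barrier _ _ _ _) (expR _) (expR _) h1 h2 KV => b e1 e2.
    by clearbody db Lb; move: (V y s) => v h1 h2 KV; nra.
Qed.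

(** * Reflections *)


Lemma continuous_mul_coord {R : realType} {N : nat} (s : R) (i : 'I_N) :
  continuous (fun x : 'rV[R]_N => s * x ord0 i).
Proof.
move=> x; have h : (fun y : 'rV[R]_N => y ord0 i) @ nbhs x --> x ord0 i.
  exact: coord_continuous.
exact: (cvgM (cvg_cst s) h).
Qed.

Section reflection.
Context {R : realType} {N : nat} (i : 'I_N) (m : R).
Implicit Types (x : 'rV[R]_N).

Definition reflect x : 'rV[R]_N := x + (2 * (m - x ord0 i)) *: delta_mx ord0 i.

Lemma sqdist_reflect x :
  sqdist 0 (reflect x) = sqdist 0 x - 4 * m * (x ord0 i - m).
Proof. by rewrite sqdist_line mxE; ring. Qed.

Lemma continuous_reflect : continuous reflect.
Proof.
move=> x.
have h : (fun y : 'rV[R]_N => y ord0 i) @ nbhs x --> x ord0 i.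
  exact: coord_continuous.
have h1 : (fun y : 'rV[R]_N => 2 * (m - y ord0 i)) @ nbhs x --> 2 * (m - x ord0 i).
  apply: cvgM; first exact: cvg_cst.
  exact: (cvgB (cvg_cst m) h).
have h2 : (fun y : 'rV[R]_N => (2 * (m - y ord0 i)) *: (delta_mx ord0 i : 'rV[R]_N))
    @ nbhs x --> (2 * (m - x ord0 i)) *: delta_mx ord0 i.
  exact: cvgZr_tmp.
exact: (cvgD cvg_id h2).
Qed.

Lemma reflect_line x j h : reflect (x + h *: delta_mx ord0 j) =
  reflect x + (if j == i then - h else h) *: delta_mx ord0 j.
Proof.
rewrite /reflect !mxE eqxx /=; have [->|ji] := eqVneq j i.
  by rewrite /= mulr1 -!addrA -!scalerDl; congr (_ + _ *: _); ring.
by rewrite /= mulr0 addr0 addrAC.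
Qed.

(** In direction [i] the reflection exchanges the neighbours at [h] and [- h], which a symmetric
    second difference does not see; the other directions are kept. *)
Lemma symlap_reflect f x L :
  symlap f (reflect x) L -> symlap (f \o reflect) x L.
Proof.
move=> fL e e0; have := fL e e0; apply: filterS => h.
rewrite (_ : second_difference (f \o reflect) x h = second_difference f (reflect x) h)//.
apply: eq_bigr => j _ /=; rewrite -scaleNr !reflect_line.
by case: eqP => _; rewrite ?opprK -?scaleNr//; ring.
Qed.

End reflection.

(** * The reaction-diffusion problem *)

Section mems.
Context {R : realType} {N : nat} (lam T : R) (u0 : 'rV[R]_N -> R).
Variable u : 'rV[R]_N -> R -> R.
Hypothesis lam_gt0 : 0 < lam.
Hypothesis u0_ge0 : forall x, closed_unit_ball x -> 0 <= u0 x.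
Hypothesis u0_decr : radially_decreasing u0.
Hypothesis u_sol : mems_solution lam u0 T u.
Implicit Types (x y : 'rV[R]_N) (t : R).

(* The nonlocal factor enters the argument only through its bounds, so that
   the equation is handled as [u_t - Delta u = rate t / (1 - u) ^ 2]. *)
Definition rate t : R :=
  lam / (1 + integral_unit_ball (fun y => (1 - u y t)^-1)) ^+ 2.

Lemma unit_ball_closed x : unit_ball x -> closed_unit_ball x.
Proof. exact: ltW. Qed.

Lemma closed_ball_cases x : closed_unit_ball x -> unit_ball x \/ unit_sphere x.
Proof.
rewrite closed_unit_ballE le_eqVlt => /orP[/eqP/unit_sphereE|]; [by right|].
by left; rewrite unit_ballE.
Qed.

Lemma nbhs_unit_ball x : unit_ball x -> nbhs x (@unit_ball R N).
Proof.
rewrite unit_ballE => x1.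
have H := @continuous_sqdist R N 0 x _ (lt_nbhsl x1).
by apply: (@filterS _ (nbhs x) _ _ _ _ H) => y /=; rewrite unit_ballE.
Qed.

Lemma mems_lt1 x t : closed_unit_ball x -> 0 < t < T -> u x t < 1.
Proof.
move=> xB tT; have [m [c [c1 H]]] := mems_bounded u_sol tT.
have /andP[t0 _] := tT.
have [|_ h] := andP (H x t xB _); first by rewrite t0 lexx.
exact: le_lt_trans h c1.
Qed.

Lemma rate_bounds t : 0 < t < T -> 0 < rate t <= lam.
Proof.
move=> tT; rewrite /rate; set I := integral_unit_ball _.
have I0 : 0 <= I.
  rewrite /I /integral_unit_ball; apply: Rintegral_ge0 => z zB.
  rewrite invr_ge0 subr_ge0 ltW//.
  by apply: mems_lt1 => //; exact: unit_ball_closed.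
have I1 : 1 <= (1 + I) ^+ 2 by rewrite exprn_ege1// lerDl.
rewrite divr_gt0//=; last exact: lt_le_trans I1.
by rewrite ler_pdivrMr ?(lt_le_trans _ I1)// ler_peMr// ltW.
Qed.

Lemma mems_pde x t : unit_ball x -> 0 < t < T -> exists d L,
  [/\ is_derive t (1 : R) (u x) d, symlap (u ^~ t) x L &
      d - L = rate t * ((1 - u x t) ^+ 2)^-1].
Proof.
move=> xB tT; have C := mems_C21 u_sol.
exists (derive1 (u x) t), (laplacian (u ^~ t) x); split.
- by split; [exact: (C21_dt C)|rewrite derive1E].
- apply: laplacian_symlap => i; last exact: (C21_dxx C).
  by apply: filterS (nbhs_unit_ball xB) => y yB; exact: (C21_dx C).
- by rewrite (mems_eq u_sol xB tT) /rate invfM mulrA mulrAC.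
Qed.

(** [g] will be the identity or a reflection. At [t = 0] it must map into the open ball, which
    avoids the corner. *)
Lemma mems_continuous_at (g : 'rV[R]_N -> 'rV[R]_N) (P : set ('rV[R]_N * R)) :
  continuous g ->
  (forall x t, P (x, t) -> [/\ closed_unit_ball (g x), 0 <= t < T &
    t = 0 -> unit_ball (g x)]) ->
  {within P, continuous (fun p => u (g p.1) p.2)}.
Proof.
move=> cg PD; apply/subspace_continuousP => -[x t] Pxt.
pose D := space_time (@closed_unit_ball R N) `]0, T[ `|`
          space_time (@unit_ball R N) `[0, T[.
have {}PD y s : P (y, s) -> D (g y, s).
  move=> /PD[yB /andP[s0 sT] s0B]; rewrite /D /space_time /=.
  have [s00|s00] := eqVneq s 0.
    by right; split; [exact: s0B|rewrite in_itv/= s0].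
  by left; split => //; rewrite in_itv/= lt_neqAle eq_sym s00 s0.
have cu := (subspace_continuousP _ _).1 (mems_continuous u_sol) _ (PD _ _ Pxt).
have cG : (g p.1, p.2) @[p --> (x, t)] --> (g x, t).
  have h2 : p.2 @[p --> (x, t)] --> t by exact: cvg_snd.
  have cg1 : g y @[y --> x] --> g x by exact: cg.
  have h1 : g p.1 @[p --> (x, t)] --> g x.
    have h0 : p.1 @[p --> (x, t)] --> x by exact: cvg_fst.
    exact: (cvg_comp _ _ h0 cg1).
  exact: (cvg_pair h1 h2).
move=> A /cu; rewrite /within /= => H.
have := cG _ H; apply: (@filterS _ (nbhs (x, t))) => -[y s] /= h Pys.
exact/h/PD.
Qed.

(** The reaction is nonnegative, so [u] is a supersolution of the heat equation with nonnegative
    data, and comparison applies with [K = 0]. *)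
Lemma mems_ge0 x t : closed_unit_ball x -> 0 < t < T -> 0 <= u x t.
Proof.
move=> xB tT; have /andP[t0 tT'] := tT.
have [m [c [c1 H]]] := mems_bounded u_sol tT.
apply: (@corner_comparison _ _ (@closed_unit_ball R N) t 0 `|m| u) => //.
- apply: compact_closed; first exact: norm_hausdorff.
  exact: compact_closed_unit_ball.
- apply: (@mems_continuous_at id) => [y|y s [/= yB /andP[s0 st] s0B]]; first exact: cvg_id.
  by split=> //; rewrite s0 (le_lt_trans st).
- move=> y s yB st; have /andP[my _] := H y s yB st.
  by apply: le_trans my; rewrite lerNl -normrN ler_norm.
- by move=> y yB' yB; rewrite (mems_initial u_sol yB) u0_ge0.
- move=> y s yB st uneg; have /andP[s0 st'] := st.
  have sT : 0 < s < T by rewrite s0 (le_lt_trans st').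
  have [yB1|yS] := closed_ball_cases yB; last first.
    by move: uneg; rewrite (mems_boundary u_sol yS sT) ltxx.
  split.
    by apply: filterS (nbhs_unit_ball yB1); exact: unit_ball_closed.
  have [d [L [ud uL E]]] := mems_pde yB1 sT.
  exists d, L; split => //; rewrite mul0r E mulr_ge0//.
    by have /andP[/ltW] := rate_bounds sT.
  by rewrite invr_ge0 sqr_ge0.
- by rewrite t0 lexx.
Qed.

(** At an interior zero [u] would be minimal in space and among past times, so [d - L <= 0], while
    the equation makes [d - L] equal to [rate t], which is positive. *)
Lemma mems_gt0 x t : unit_ball x -> 0 < t < T -> 0 < u x t.
Proof.
move=> xB tT; rewrite lt_neqAle mems_ge0// ?andbT; last exact: unit_ball_closed.
apply/eqP => ux0; have [d [L [ud uL E]]] := mems_pde xB tT.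
have /andP[t0 tT'] := tT; have /andP[r0 _] := rate_bounds tT.
have d0 : d <= 0.
  apply: (left_min_derive_le0 ud); apply: filterS (lt_nbhsr t0) => s s0 st.
  rewrite -ux0 mems_ge0//; first exact: unit_ball_closed.
  by rewrite s0 (lt_trans st).
have L0 : 0 <= L.
  apply: (symlap_le _ _ (symlap_cst (u x t) x) uL) => //.
  apply: filterS (nbhs_unit_ball xB) => y yB; rewrite -ux0.
  by apply: mems_ge0 => //; exact: unit_ball_closed.
by move: E; rewrite -ux0 subr0 expr1n invr1 mulr1; lra.
Qed.

(** * Monotonicity in each coordinate by reflection *)

(** [s] is a sign: with [s ^+ 2 = 1] the cutting hyperplane is [x ord0 i = s * mu]. *)
Definition cap (i : 'I_N) (s mu : R) : set 'rV[R]_N :=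
  [set x | closed_unit_ball x /\ mu <= s * x ord0 i].

Lemma cap_closed i s mu : closed (cap i s mu).
Proof.
have c1 : closed (@closed_unit_ball R N).
  by apply: compact_closed; [exact: norm_hausdorff|exact: compact_closed_unit_ball].
have c2 : closed ((fun x : 'rV[R]_N => s * x ord0 i) @^-1` [set z | mu <= z]).
  apply: preimage_closed => [x _|]; last exact: closed_ge.
  exact: continuous_mul_coord.
exact: (closedI c1 c2).
Qed.

Lemma nbhs_cap i s mu x : unit_ball x -> mu < s * x ord0 i -> nbhs x (cap i s mu).
Proof.
move=> xB xmu; have H := @continuous_mul_coord _ _ s i x _ (lt_nbhsr xmu).
apply: (@filterS2 _ (nbhs x) _ _ _ _ _ (nbhs_unit_ball xB) H) => y yB /= ymu.
by split; [exact: unit_ball_closed|exact: ltW].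
Qed.

(** As [0 <= mu], the hyperplane does not leave the origin strictly on the side of the cap, so
    reflecting a cap point moves it no farther from the origin. *)
Lemma reflect_cap i s mu x : s ^+ 2 = 1 -> 0 <= mu -> cap i s mu x ->
  sqdist 0 (reflect i (s * mu) x) <= sqdist 0 x.
Proof.
move=> s1 mu0 [xB xmu]; rewrite sqdist_reflect lerBlDr lerDl.
rewrite (_ : _ * _ = 4 * mu * (s * x ord0 i - s ^+ 2 * mu)); last by ring.
by rewrite s1 mul1r mulr_ge0 ?subr_ge0// mulr_ge0.
Qed.

Lemma reflect_cap_ball i s mu x : s ^+ 2 = 1 -> 0 <= mu -> cap i s mu x ->
  closed_unit_ball (reflect i (s * mu) x).
Proof.
move=> s1 mu0 xcap; have := xcap => -[]; rewrite !closed_unit_ballE => xB _.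
exact: le_trans (reflect_cap s1 mu0 xcap) xB.
Qed.

Lemma reflect_cap_unit_ball i s mu x : s ^+ 2 = 1 -> 0 <= mu -> cap i s mu x ->
  unit_ball x -> unit_ball (reflect i (s * mu) x).
Proof.
by move=> s1 mu0 xcap; rewrite !unit_ballE; exact: le_lt_trans (reflect_cap s1 mu0 xcap).
Qed.

Lemma reflect_difference_pde i s mu x t : s ^+ 2 = 1 -> 0 <= mu ->
  cap i s mu x -> unit_ball x -> 0 < t < T -> exists d L,
  [/\ is_derive t (1 : R) (fun t => u (reflect i (s * mu) x) t - u x t) d,
      symlap (fun y => u (reflect i (s * mu) y) t - u y t) x L &
      d - L = rate t * (((1 - u (reflect i (s * mu) x) t) ^+ 2)^-1 -
                        ((1 - u x t) ^+ 2)^-1)].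
Proof.
move=> s1 mu0 xcap xB tT.
have [d [L [dd LL E]]] := mems_pde xB tT.
have [d' [L' [dd' LL' E']]] := mems_pde (reflect_cap_unit_ball s1 mu0 xcap xB) tT.
exists (d' - d), (L' - L); split; last by rewrite mulrBr -E -E'; ring.
- exact: is_deriveB.
- by apply: symlapB LL; exact: (symlap_reflect LL').
Qed.

(** The difference of the fractions is (a - b) A B (A + B), with A and B the inverses of 1 - a and 1
    - b, both at most 1 / (1 - c). This supplies the constant [K] when [u] is compared with its
    reflection. *)
Lemma reaction_lipschitz (a b c r : R) : a <= b -> b <= c -> c < 1 -> 0 <= r <= lam ->
  2 * lam / (1 - c) ^+ 3 * (a - b) <= r * (((1 - a) ^+ 2)^-1 - ((1 - b) ^+ 2)^-1).
Proof.
move=> ab bc c1 /andP[r0 rl].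
have cp : 0 < 1 - c by rewrite subr_gt0.
have bp : 0 < 1 - b by lra.
have ap : 0 < 1 - a by lra.
pose A := (1 - a)^-1; pose B := (1 - b)^-1; pose C := (1 - c)^-1.
have A0 : 0 < A by rewrite invr_gt0.
have B0 : 0 < B by rewrite invr_gt0.
have AC : A <= C by rewrite lef_pV2 ?posrE//; lra.
have BC : B <= C by rewrite lef_pV2 ?posrE//; lra.
have C0 : 0 < C := lt_le_trans A0 AC.
rewrite -subr_ge0 (_ : _ - _ = (b - a) * (2 * lam * C ^+ 3 - r * (A * B * (A + B)))); last first.
  by rewrite /A /B /C; field; rewrite !gt_eqF.
rewrite mulr_ge0 ?subr_ge0//.
rewrite (_ : 2 * lam * C ^+ 3 = lam * (C * C * (C + C))); last by ring.
apply: ler_pM => //; first by rewrite !mulr_ge0 ?addr_ge0 ?ltW.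
have AB : A * B <= C * C by rewrite ler_pM// ltW.
apply: ler_pM => //; [exact: mulr_ge0 (ltW A0) (ltW B0)| |exact: lerD].
exact: addr_ge0 (ltW A0) (ltW B0).
Qed.

Lemma reaction_mono (a b : R) : a <= b -> b < 1 ->
  ((1 - a) ^+ 2)^-1 <= ((1 - b) ^+ 2)^-1.
Proof.
move=> ab b1; have bp : 0 < 1 - b by rewrite subr_gt0.
have ap : 0 < 1 - a by lra.
rewrite lef_pV2 ?posrE ?exprn_gt0// ler_pXn2r ?nnegrE ?(ltW ap) ?(ltW bp)//; lra.
Qed.

(** The difference of the reflected solution and [u] is nonnegative at time 0 because [u0] is
    radially decreasing; [reaction_lipschitz] gives the inequality that [corner_comparison] asks
    for. *)
Lemma reflect_le i s mu x t : s ^+ 2 = 1 -> 0 <= mu -> cap i s mu x -> 0 < t < T ->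
  u x t <= u (reflect i (s * mu) x) t.
Proof.
move=> s1 mu0 xcap tT; have /andP[t0 tT'] := tT.
have [m [c [c1 H]]] := mems_bounded u_sol tT.
pose g := reflect i (s * mu).
rewrite -subr_ge0.
apply: (@corner_comparison _ _ (cap i s mu) t (2 * lam / (1 - c) ^+ 3) `|m - c|
  (fun x t => u (g x) t - u x t)) => //.
- exact: cap_closed.
- by move=> y [].
- by rewrite divr_ge0 ?mulr_ge0 ?exprn_ge0 ?subr_ge0// ltW.
- apply/subspace_continuousP => p Pp.
  have /subspace_continuousP c1' : {within
      [set p | [/\ cap i s mu p.1, 0 <= p.2 <= t & p.2 = 0 -> unit_ball p.1]],
      continuous (fun p => u (g p.1) p.2)}.
    apply: mems_continuous_at => [|y r [/= ycap /andP[r0 rt] yB]].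
      exact: continuous_reflect.
    split; [exact: reflect_cap_ball|by rewrite r0 (le_lt_trans rt)|].
    by move=> /yB; exact: reflect_cap_unit_ball.
  have /subspace_continuousP c2' : {within
      [set p | [/\ cap i s mu p.1, 0 <= p.2 <= t & p.2 = 0 -> unit_ball p.1]],
      continuous (fun p => u p.1 p.2)}.
    apply: (@mems_continuous_at id) => [y|y r [/= [yB' _] /andP[r0 rt] yB]].
      exact: cvg_id.
    by split => //; rewrite r0 (le_lt_trans rt).
  exact: cvgB (c1' _ Pp) (c2' _ Pp).
- move=> y r ycap rt; have [yB _] := ycap.
  have /andP[h1 h2] := H _ _ yB rt.
  have /andP[h3 h4] := H _ _ (reflect_cap_ball s1 mu0 ycap) rt.
  apply: (@le_trans _ _ (m - c)); last by rewrite lerB.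
  by rewrite lerNl -normrN ler_norm.
- move=> y ycap yB; have gB := reflect_cap_unit_ball s1 mu0 ycap yB.
  rewrite !(mems_initial u_sol)// subr_ge0.
  have [phi u0E phi_decr] := u0_decr.
  rewrite !u0E; try exact: unit_ball_closed.
  apply: phi_decr; [exact: sqrtr_ge0| |exact: unit_ball_closed].
  by rewrite !enormE ler_wsqrtr// reflect_cap.
(* A negative value cannot occur on the spherical part, where [u] vanishes and its reflection is
   nonnegative, nor on the flat part, which the reflection fixes. *)
- move=> y r ycap rt Vneg; have /andP[r0 rt'] := rt.
  have rT : 0 < r < T by rewrite r0 (le_lt_trans rt').
  have [yB ymu] := ycap.
  have yB1 : unit_ball y.
    have [//|yS] := closed_ball_cases yB.
    move: Vneg; rewrite (mems_boundary u_sol yS rT) subr0 ltNge.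
    by rewrite mems_ge0//; exact: reflect_cap_ball.
  split.
    apply: nbhs_cap => //; rewrite lt_neqAle ymu andbT.
    apply: contraTneq Vneg => mus; rewrite (_ : g y = y) ?subrr ?ltxx//.
    rewrite /g /reflect mus mulrA -expr2 s1 mul1r subrr mulr0 scale0r addr0//.
  have [d [L [dd LL E]]] := reflect_difference_pde s1 mu0 ycap yB1 rT.
  exists d, L; split => //; rewrite E; apply: reaction_lipschitz => //.
  + by rewrite -subr_le0 ltW.
  + by have /andP[] := H _ _ yB rt.
  + by have /andP[/ltW ->] := rate_bounds rT.
- by rewrite t0 lexx.
Qed.

Lemma coord_decreasing i x z t : closed_unit_ball x -> `|z| <= `|x ord0 i| ->
  0 < t < T -> u x t <= u (x + (z - x ord0 i) *: delta_mx ord0 i) t.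
Proof.
move=> xB zx tT; set a := x ord0 i.
pose s : R := if 0 <= a then 1 else -1.
have s1 : s ^+ 2 = 1 by rewrite /s; case: ifP; rewrite ?sqrrN expr1n.
(* The hyperplane lies midway between the coordinates [a] and [z]; the bound on the modulus of [z]
   gives [0 <= mu <= s * a]. *)
pose mu := s * ((a + z) / 2).
have smu : s * mu = (a + z) / 2 by rewrite /mu mulrA -expr2 s1 mul1r.
have : 0 <= mu /\ mu <= s * a.
  move: zx; rewrite -/a /mu /s; have [a0|a0] := leP 0 a.
    by rewrite (ger0_norm a0) ler_norml => /andP[]; lra.
  by rewrite (ltr0_norm a0) ler_norml => /andP[]; lra.
move=> [mu0 mua]; have := @reflect_le i s mu x t s1 mu0 (conj xB mua) tT.
by rewrite smu /reflect -/a (_ : 2 * _ = z - a)//; field.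
Qed.

Lemma coordinatewise_decreasing x y t : closed_unit_ball y ->
  (forall i, `|x ord0 i| <= `|y ord0 i|) -> 0 < t < T -> u y t <= u x t.
Proof.
move=> yB xy tT.
(* Coordinates are replaced one at a time; no modulus grows, so every intermediate point stays in
   the ball. *)
pose w n : 'rV[R]_N := \row_i (if (i < n)%N then x ord0 i else y ord0 i).
have wB n : closed_unit_ball (w n).
  move: yB; rewrite !closed_unit_ballE; apply: le_trans; apply: ler_sum => i _.
  rewrite !mxE !subr0 -(real_normK (num_real (if _ then _ else _))).
  rewrite -(real_normK (num_real (y _ _))) ler_pXn2r ?nnegrE//.
  by case: ifP.
suff main n : (n <= N)%N -> u y t <= u (w n) t.
  rewrite (_ : x = w N) ?main//; apply/rowP => i.
  by rewrite mxE ltn_ord.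
elim: n => [_|n IH nN].
  by rewrite (_ : w 0 = y)//; apply/rowP => i; rewrite mxE.
apply: (le_trans (IH (ltnW nN))); pose i := Ordinal nN.
have wi : w n ord0 i = y ord0 i by rewrite mxE ltnn.
have := @coord_decreasing i (w n) (x ord0 i) t (wB n).
rewrite wi => /(_ (xy i) tT) /le_trans; apply; rewrite le_eqVlt; apply/orP; left.
apply/eqP; congr (u _ t); apply/rowP => j; rewrite !mxE eqxx /=.
have [->|ji] := eqVneq j i.
  by rewrite /= ltnn ltnSn mulr1; ring.
have {}ji : val j != n by apply: contra ji => /eqP jn; apply/eqP/val_inj.
by rewrite mulr0 addr0 ltnS [in RHS]leq_eqVlt (negbTE ji).
Qed.

(** * Explicit subsolutions and the gap below 1 *)

(** As a supersolution of the heat equation, [u] stays above the subsolution [z], which vanishes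
    where [sqdist 0 x = rho1] and decays exponentially in time, so it keeps a positive bound on the
    smaller ball up to the finite time [T]. *)
Lemma mems_lower_bound (rho rho1 t0 : R) : 0 <= rho -> rho < rho1 -> rho1 < 1 ->
  0 < t0 < T ->
  exists2 c, 0 < c & forall x t, sqdist 0 x <= rho -> t0 < t < T -> c <= u x t.
Proof.
move=> rho0 rho_lt rho1_lt t0T; have /andP[t00 t0T'] := t0T.
have rho1_gt0 : 0 < rho1 := le_lt_trans rho0 rho_lt.
pose Om : set 'rV[R]_N := [set x | sqdist 0 x <= rho1].
have OmB x : Om x -> unit_ball x.
  by rewrite /Om /= unit_ballE => h; exact: le_lt_trans h rho1_lt.
have cOm : compact Om.
  apply: (subclosed_compact _ (@compact_closed_unit_ball R N)) => [|x /OmB]; last first.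
    exact: unit_ball_closed.
  have H : closed (sqdist (0 : 'rV[R]_N) @^-1` [set y | y <= rho1]).
    by apply: preimage_closed => [x _|]; [exact: continuous_sqdist|exact: closed_le].
  exact: H.
have [e e0 eu] : exists2 e, 0 < e & forall x, Om x -> e <= u x t0.
  have cu : {within Om, continuous (fun x => u x t0)}.
    apply/subspace_continuousP => x Omx.
    have /subspace_continuousP cu : {within Om `*` [set t0],
        continuous (fun p => u p.1 p.2)}.
      apply: (@mems_continuous_at id) => [y|y s [/= Omy ->]]; first exact: cvg_id.
      by split => [||_]; [exact/unit_ball_closed/OmB|rewrite ltW|exact: OmB].
    move=> A /(cu (x, t0) (conj Omx erefl)); rewrite /within /= => H.
    have h2 : (fun=> t0) @ nbhs x --> t0 by exact: cvg_cst.
    have hp : (y, t0) @[y --> x] --> (x, t0) by exact: (cvg_pair cvg_id h2).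
    have H' := hp _ H.
    by apply: (@filterS _ (nbhs x) _ _ _ _ H') => y /= h Omy; exact: h.
  have Om0 : Om 0.
    by rewrite /Om /= /sqdist big1 ?(ltW rho1_gt0)// => i _; rewrite mxE subr0 expr0n.
  have [|x0 /set_mem Omx0 x0min] := EVT_min_rV _ cOm cu; first by exists 0.
  exists (u x0 t0); first by apply: mems_gt0 => //; exact: OmB.
  by move=> x Omx; apply: x0min; exact: mem_set.
(* [k] makes the discriminant in [h2] below vanish. *)
pose k := (8 + 4 * N%:R) ^+ 2 / (32 * rho1).
have k0 : 0 <= k by rewrite divr_ge0 ?sqr_ge0// mulr_ge0// ltW.
pose z x t := e * expR (- (k * (t - t0))) * (rho1 - sqdist 0 x) ^+ 2.
have key x t : Om x -> t0 < t < T -> z x t <= u x t.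
  move=> Omx /andP[t0t tT]; rewrite -subr_ge0.
  apply: (@parabolic_comparison _ _ Om (Om `*` `[t0, t]) t0 t 0
      (fun x t => u x t - z x t)) => //.
  - by apply: compact_setX => //; exact: segment_compact.
  - apply/subspace_continuousP => -[y s] Pys; apply: cvgB.
      have /subspace_continuousP : {within Om `*` `[t0, t],
          continuous (fun p => u p.1 p.2)}.
        apply: (@mems_continuous_at id) => [v|v r [/= Omv]]; first exact: cvg_id.
        rewrite in_itv/= => /andP[t0r rt].
        split => [||_]; [exact/unit_ball_closed/OmB| |exact: OmB].
        by rewrite (le_trans (ltW t00) t0r) (le_lt_trans rt).
      exact.
    apply: cvg_within_filter; apply: cvgM.
      apply: cvgM; first exact: cvg_cst.
      apply: (@cvg_comp _ _ _ (fun q : 'rV[R]_N * R => - (k * (q.2 - t0))) expR).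
        apply: cvgN; apply: cvgM; first exact: cvg_cst.
        by apply: cvgB; [exact: cvg_snd|exact: cvg_cst].
      exact: continuous_expR.
    apply: (@cvg_comp _ _ _ (fun q : 'rV[R]_N * R => rho1 - sqdist 0 q.1)
      (fun z : R => z ^+ 2)); last exact: exprn_continuous.
    apply: cvgB; first exact: cvg_cst.
    by apply: (cvg_comp _ _ cvg_fst); exact: continuous_sqdist.
  - move=> y s Omy /andP[t0s st] _; split=> //=.
    by rewrite in_itv/= ltW.
  - move=> y s [/= Omy]; rewrite in_itv/= => /andP[t0s st] Vneg.
    have sT : 0 < s < T by rewrite (lt_le_trans t00 t0s) (le_lt_trans st).
    have yB := OmB _ Omy.
    have {}t0s : t0 < s.
      rewrite lt_neqAle t0s andbT; apply: contraTneq Vneg => <-.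
      rewrite -leNgt subr_ge0 /z subrr mulr0 oppr0 expR0 mulr1.
      apply: le_trans (eu _ Omy); rewrite ler_piMr ?(ltW e0)//.
      have := sqdist_ge0 0 y; move: Omy; rewrite /Om /= => h1 h2.
      by rewrite expr_le1//; lra.
    have yrho : sqdist 0 y < rho1.
      move: Omy; rewrite /Om /= le_eqVlt => /orP[/eqP yr|//].
      move: Vneg; rewrite /z yr subrr expr0n/= mulr0 subr0 ltNge.
      by rewrite mems_ge0//; exact: unit_ball_closed.
    split; first by rewrite t0s st.
      have H := @continuous_sqdist R N 0 y _ (lt_nbhsl yrho).
      by apply: (@filterS _ (nbhs y) _ _ _ _ H) => v /= /ltW.
    have [d [L [ud uL E]]] := mems_pde yB sT.
    set c := e * expR (- (k * (s - t0))).
    have c0 : 0 < c by rewrite mulr_gt0// expR_gt0.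
    have De : is_derive s (1 : R) (fun s : R => expR (- (k * (s - t0))))
        (expR (- (k * (s - t0))) * - k).
      apply: (@is_derive1_comp _ expR (fun s : R => - (k * (s - t0)))).
      by apply: is_derive_eq; rewrite /GRing.scale /=; ring.
    have Dz : is_derive s (1 : R) (z y) (- (k * c * (rho1 - sqdist 0 y) ^+ 2)).
      by rewrite /z; apply: is_derive_eq; rewrite /GRing.scale /= /c; ring.
    have Lz : symlap (z ^~ s) y (4 * sqdist 0 y * (c * 2) +
        2 * N%:R * (c * (- 2 * (rho1 - sqdist 0 y)))).
      apply: (@symlap_radial _ _ (fun r => c * (rho1 - r) ^+ 2)
        (fun r => c * (- 2 * (rho1 - r)))).
        apply: (@filterE _ (nbhs (sqdist 0 y))) => r.
        by apply: is_derive_eq; rewrite /GRing.scale /=; ring.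
      by apply: is_derive_eq; rewrite /GRing.scale /=; ring.
    exists (d - - (k * c * (rho1 - sqdist 0 y) ^+ 2)).
    eexists; split; first exact: is_deriveB.
      exact: (symlapB uL Lz).
    set q := rho1 - sqdist 0 y.
    have -> : sqdist 0 y = rho1 - q by rewrite /q; ring.
    have h1 : 0 <= d - L.
      rewrite E mulr_ge0 ?invr_ge0 ?sqr_ge0//.
      by have /andP[/ltW] := rate_bounds sT.
    (* The heat operator applied to [z] gives [- c] times this quadratic in [q]. *)
    have h2 : 0 <= k * q ^+ 2 + 8 * rho1 - (8 + 4 * N%:R) * q.
      rewrite (_ : _ - _ = ((8 + 4 * N%:R) * q - 16 * rho1) ^+ 2 / (32 * rho1)).
        by rewrite divr_ge0 ?sqr_ge0// mulr_ge0// ltW.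
      by rewrite /k; field; rewrite gt_eqF.
    have := mulr_ge0 (ltW c0) h2; lra.
  - by rewrite t0t lexx.
exists (e * expR (- (k * (T - t0))) * (rho1 - rho) ^+ 2).
  by rewrite !mulr_gt0 ?expR_gt0// subr_gt0.
move=> x t xr /andP[t0t tT].
apply: le_trans (key x t _ _); last by rewrite t0t.
  apply: ler_pM; rewrite ?sqr_ge0// ?mulr_ge0 ?expR_ge0 ?(ltW e0)//.
    by rewrite ler_pM2l// ler_expR lerN2; apply: ler_wpM2l => //; lra.
  by rewrite ler_pXn2r// ?nnegrE; lra.
by rewrite /Om /= (le_trans xr)// ltW.
Qed.

(** The reflected solution exceeds [u] by at least a Gaussian subsolution centred at [p]. As the
    reflected value is below 1, a positive bound on the excess at the given point keeps [u] off 1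
    there. *)
Lemma quenching_gap i (s rho : R) : s ^+ 2 = 1 -> 0 < rho < 1 -> 0 < T ->
  exists c t1, [/\ 0 < c, t1 < T & forall t, t1 < t < T ->
    u ((s * rho) *: delta_mx ord0 i) t <= 1 - c].
Proof.
move=> s1 /andP[rho0 rho1] T0.
pose mu := rho / 2; have mu0 : 0 < mu by rewrite divr_gt0.
have mu1 : mu < 1 by rewrite /mu; lra.
have mu_rho : mu < rho by rewrite /mu; lra.
pose g := reflect i (s * mu).
pose p : 'rV[R]_N := (2 * s) *: delta_mx ord0 i.
have pE x : sqdist p x = sqdist 0 x - 4 * (s * x ord0 i) + 4.
  rewrite /sqdist (bigD1 i)//= [in RHS](bigD1 i)//= !mxE !eqxx mulr1 subr0.
  rewrite [X in _ + X = _](_ : _ =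
      \sum_(j < N | j != i) (x ord0 j - (0 : 'rV[R]_N) ord0 j) ^+ 2).
    move: (\sum_(j < N | j != i) _) (x ord0 i) => A y; move: s1; nra.
  by apply: eq_bigr => j ji; rewrite !mxE (negbTE ji) andbF mulr0.
have coord_le x : (s * x ord0 i) ^+ 2 <= sqdist 0 x.
  by rewrite exprMn s1 mul1r; have := sqdist_ge_coord 0 x i; rewrite mxE subr0.
have coord_le1 x : closed_unit_ball x -> s * x ord0 i <= 1.
  rewrite closed_unit_ballE => xB; have := le_trans (coord_le x) xB.
  by rewrite -[X in _ <= X -> _](expr1n _ 2); nra.
have p_ge x : (2 - s * x ord0 i) ^+ 2 <= sqdist p x.
  by rewrite pE; have := coord_le x; lra.
have p_ge1 x : closed_unit_ball x -> 1 <= sqdist p x.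
  by move=> /coord_le1 h; apply: le_trans (p_ge x); nra.
(* [2 - mu] is the distance from [p] to the reflecting hyperplane, so points with [sqdist p x < R2]
   lie strictly on the side of the cap. *)
pose R2 := (2 - mu) ^+ 2.
have R2_gt1 : 1 < R2 by rewrite /R2; nra.
have R2_gt0 : 0 < R2 by lra.
have p_cap x : sqdist p x < R2 -> mu < s * x ord0 i.
  by move=> /(le_lt_trans (p_ge x)); rewrite /R2 => h; nra.
(* The Gaussian starts at [h]: a positive time, as the lower bound on [u] requires, and one with
   [T - h = h], which is used in [kappa]. *)
pose h := T / 2; have h0 : 0 < h by rewrite divr_gt0.
have [c1 c10 sphere_bound] : exists2 c, 0 < c & forall x t, unit_sphere x ->
    sqdist p x < R2 -> h < t < T -> c <= u (g x) t.
  (* On the sphere [sqdist p x < R2] means [4 * (s * x ord0 i - mu) > 1 - mu ^+ 2], so the reflected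
     point has squared norm at most [r]. *)
  pose r := 1 - mu * (1 - mu ^+ 2).
  have r01 : 0 <= r < 1 by rewrite /r; apply/andP; split; nra.
  have /andP[r0 r1] := r01.
  have [|||c c0 H] := @mems_lower_bound r ((1 + r) / 2) h r0.
  - by lra.
  - by lra.
  - by rewrite h0 /h; lra.
  exists c => // x t /unit_sphereE xS pR tT; apply: H => //.
  have := pR; rewrite pE xS /R2 sqdist_reflect xS => {}pR.
  rewrite (_ : 4 * (s * mu) * _ = 4 * mu * (s * x ord0 i - s ^+ 2 * mu)); last by ring.
  rewrite s1 mul1r /r lerB//; move: (s * x ord0 i) pR => y pR; nra.
(* [(4 a - 1) |x - p|^2 >= 2 N (t - h)] holds on the ball, which makes [z] a
   subsolution; [kappa] makes [z] nonpositive where [sqdist p x >= R2] and, on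
   the whole ball, at the initial time [t0]. *)
pose a : R := (1 + N%:R * T) / 4.
have a0 : 0 < a by rewrite divr_gt0// ltr_pwDl// mulr_ge0// ltW.
pose kappa := expR (- (a * R2 / h)).
pose z x t := c1 * (expR (- (a * sqdist p x / (t - h))) - kappa).
have z_le x t : 0 < t - h -> z x t <= c1.
  move=> t0; rewrite /z ler_piMr ?(ltW c10)// lerBlDr.
  rewrite (le_trans (_ : _ <= 1)) ?lerDl ?expR_ge0//.
  by rewrite -expR0 ler_expR oppr_le0 divr_ge0 ?(ltW t0)// mulr_ge0 ?sqdist_ge0// ltW.
have z_neg x t : 0 < t - h -> t < T -> 0 < z x t -> sqdist p x < R2.
  move=> t0 tT; rewrite /z pmulr_rgt0// subr_gt0 ltr_expR ltrN2.
  rewrite ltr_pdivrMr// => H; rewrite -(ltr_pM2l a0); apply: lt_le_trans H _.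
  rewrite mulrAC ler_pdivrMr// ler_pM2l; last exact: mulr_gt0.
  by move: tT; rewrite /h; lra.
(* At this time the exponent is [- (sqdist p x * (a * R2 / h))], at most that of [kappa] because
   [1 <= sqdist p x] on the ball. *)
pose t0 := h + h / R2.
have hR2 : 0 < h / R2 by rewrite divr_gt0.
have hR2h : h / R2 < h by rewrite ltr_pdivrMr// ltr_pMr.
have t0T : h < t0 < T by rewrite /t0; move: hR2 hR2h; rewrite /h; lra.
have /andP[ht0 t0T'] := t0T.
have key x t : cap i s mu x -> t0 < t < T -> z x t <= u (g x) t - u x t.
  move=> xcap /andP[t0t tT]; rewrite -subr_ge0.
  have V_ge0 y r : cap i s mu y -> t0 <= r <= t ->
      0 <= u (g y) r - u y r /\ 0 < r < T.
    move=> ycap /andP[t0r rt].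
    have rT : 0 < r < T.
      by rewrite (le_lt_trans rt tT) (lt_le_trans h0)// (le_trans (ltW ht0)).
    by rewrite subr_ge0 reflect_le// ltW.
  apply: (@parabolic_comparison _ _ (cap i s mu) (cap i s mu `*` `[t0, t]) t0 t 0
      (fun x t => u (g x) t - u x t - z x t)) => //.
  - apply: compact_setX; last exact: segment_compact.
    apply: (subclosed_compact _ (@compact_closed_unit_ball R N)) => [|y []//].
    exact: cap_closed.
  - apply/subspace_continuousP => p0 Pp0; have [/= p0cap] := Pp0.
    rewrite in_itv/= => /andP[t0p0 p0t].
    have rbound r : t0 <= r <= t -> 0 <= r < T.
      move=> /andP[h1 h2]; rewrite (le_lt_trans h2 tT) andbT.
      by rewrite ltW// (lt_le_trans h0)// (le_trans (ltW ht0)).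
    have r0 r : t0 <= r <= t -> r = 0 -> False.
      by move=> /andP[h1 _] r0; move: h1; rewrite r0; move: h0 ht0; lra.
    have /subspace_continuousP cg : {within cap i s mu `*` `[t0, t],
        continuous (fun q => u (g q.1) q.2)}.
      apply: mems_continuous_at => [y|y r [/= ycap]]; first exact: continuous_reflect.
      rewrite in_itv/= => rt; split; [|exact: rbound|by move/(r0 _ rt)].
      by apply: reflect_cap_ball => //; exact: ltW.
    have /subspace_continuousP cu : {within cap i s mu `*` `[t0, t],
        continuous (fun q => u q.1 q.2)}.
      apply: (@mems_continuous_at id) => [y|y r [/= [yB _]]]; first exact: cvg_id.
      by rewrite in_itv/= => rt; split; [|exact: rbound|move/(r0 _ rt)].
    have cz : z q.1 q.2 @[q --> p0] --> z p0.1 p0.2.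
      apply: cvgM; first exact: cvg_cst.
      apply: cvgB; last exact: cvg_cst.
      apply: (@cvg_comp _ _ _ (fun q : 'rV[R]_N * R =>
        - (a * sqdist p q.1 / (q.2 - h))) expR); last exact: continuous_expR.
      apply: cvgN; apply: cvgM.
        apply: cvgM; first exact: cvg_cst.
        by apply: (cvg_comp _ _ cvg_fst); exact: continuous_sqdist.
      apply: cvgV; first by rewrite subr_eq0 gt_eqF// (lt_le_trans ht0).
      by apply: cvgB; [exact: cvg_snd|exact: cvg_cst].
    apply: cvgB; last exact: cvg_within_filter.
    exact: cvgB (cg _ Pp0) (cu _ Pp0).
  - move=> y r ycap /andP[t0r rt] _; split=> //=.
    by rewrite in_itv/= ltW.
  - move=> y r [/= ycap]; rewrite in_itv/= => rt Vneg.
    have [w0 rT] := V_ge0 _ _ ycap rt; have /andP[t0r rt'] := rt.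
    have [yB ymu] := ycap; have /andP[r0 rT'] := rT.
    have hr : 0 < r - h by rewrite subr_gt0 (lt_le_trans ht0).
    (* The excess being nonnegative, the bound can fail only where [z] is positive, which excludes
       the flat part and the initial time. On the sphere it holds because [z] is at most [c1]. *)
    have zpos : 0 < z y r by move: Vneg w0; lra.
    have yR := z_neg _ _ hr rT' zpos.
    have {}t0r : t0 < r.
      rewrite lt_neqAle t0r andbT; apply: contraTneq zpos => <-.
      rewrite -leNgt /z pmulr_rle0// subr_le0 ler_expR lerN2.
      rewrite /t0 addrAC subrr add0r.
      rewrite (_ : _ / (h / R2) = sqdist p y * (a * R2 / h)); last first.
        by field; rewrite !gt_eqF.
      by rewrite ler_peMl ?p_ge1//; apply/ltW/divr_gt0 => //; exact: mulr_gt0.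
    have yB1 : unit_ball y.
      have [//|yS] := closed_ball_cases yB.
      have hrT : h < r < T by rewrite (lt_trans ht0 t0r).
      move: Vneg; rewrite (mems_boundary u_sol yS rT) subr0.
      have := sphere_bound _ _ yS yR hrT; have := z_le y _ hr; lra.
    split; [by rewrite t0r rt'|by apply: nbhs_cap => //; exact: p_cap|].
    have [d [L [dd LL E]]] := reflect_difference_pde s1 (ltW mu0) ycap yB1 rT.
    set sg := r - h; set e := expR (- (a * sqdist p y / sg)).
    have sg0 : sg != 0 by rewrite gt_eqF.
    have Dz : is_derive r (1 : R) (z y) (c1 * (e * (a * sqdist p y / sg ^+ 2))).
      have De : is_derive r (1 : R) (fun r : R => expR (- (a * sqdist p y / (r - h))))
          (e * (a * sqdist p y / sg ^+ 2)).
        apply: (@is_derive1_comp _ expR (fun r : R => - (a * sqdist p y / (r - h)))).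
        have Dinv : is_derive r (1 : R) (fun r : R => (r - h)^-1) (- sg ^- 2).
          apply: is_derive_eq.
          by rewrite /GRing.scale /= -/sg; field.
        by apply: is_derive_eq; rewrite /GRing.scale /=; field.
      by rewrite /z; apply: is_derive_eq; rewrite /GRing.scale /=; ring.
    pose F q := c1 * (expR (- (a * q / sg)) - kappa).
    pose F1 q := c1 * (expR (- (a * q / sg)) * - (a / sg)).
    have De q : is_derive (q : R) (1 : R) (fun q : R => expR (- (a * q / sg)))
        (expR (- (a * q / sg)) * - (a / sg)).
      apply: (@is_derive1_comp _ expR (fun q : R => - (a * q / sg))).
      by apply: is_derive_eq; rewrite /GRing.scale /=; field.
    have Lz : symlap (z ^~ r) y (4 * sqdist p y * (c1 * (e * (a / sg) ^+ 2)) +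
        2 * N%:R * F1 (sqdist p y)).
      apply: (@symlap_radial _ _ F F1).
        apply: (@filterE _ (nbhs (sqdist p y))) => q; rewrite /F /F1.
        by apply: is_derive_eq; rewrite /GRing.scale /=; ring.
      by rewrite /F1; apply: is_derive_eq; rewrite /GRing.scale /= -/e; ring.
    eexists; eexists; split; [exact: is_deriveB|exact: symlapB LL Lz|].
    have h1 : 0 <= d - L.
      have /andP[rr0 _] := rate_bounds rT.
      rewrite E mulr_ge0 ?(ltW rr0)// subr_ge0 reaction_mono//; last first.
        by apply: mems_lt1 => //; apply: reflect_cap_ball => //; exact: ltW.
      by rewrite -subr_ge0.
    (* This is the Laplacian of [z] minus its time derivative; its sign comes from
       [4 * a - 1 = N%:R * T], [1 <= sqdist p y] and [2 * sg <= T]. *)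
    have h2 : 0 <= c1 * e * a / sg ^+ 2 * ((4 * a - 1) * sqdist p y - 2 * N%:R * sg).
      rewrite mulr_ge0//; first apply: divr_ge0; rewrite ?sqr_ge0//.
        exact: mulr_ge0 (mulr_ge0 (ltW c10) (expR_ge0 _)) (ltW a0).
      rewrite subr_ge0 (_ : 4 * a - 1 = N%:R * T); last by rewrite /a; field.
      apply: (@le_trans _ _ (N%:R * T)); last first.
        by rewrite ler_peMr ?p_ge1// mulr_ge0// ltW.
      by rewrite mulrC mulrA mulrC ler_wpM2l// /sg; move: rT'; rewrite /h; lra.
    rewrite mul0r; move: h1 h2; rewrite /F1 -/e.
    rewrite (_ : c1 * e * a / sg ^+ 2 * _ = 4 * sqdist p y * (c1 * (e * (a / sg) ^+ 2)) +
      2 * N%:R * (c1 * (e * - (a / sg))) - c1 * (e * (a * sqdist p y / sg ^+ 2))).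
      by lra.
    by field.
  - by rewrite t0t lexx.
pose y : 'rV[R]_N := (s * rho) *: delta_mx ord0 i.
have yi : s * y ord0 i = rho.
  by rewrite /y !mxE !eqxx mulr1 mulrA -expr2 s1 mul1r.
have y0 : sqdist 0 y = rho ^+ 2.
  rewrite /sqdist (bigD1 i)//= big1 => [|j ji]; last first.
    by rewrite !mxE (negbTE ji) andbF mulr0 subr0 expr0n.
  by rewrite addr0 !mxE !eqxx mulr1 subr0 exprMn s1 mul1r.
have yB : closed_unit_ball y by rewrite closed_unit_ballE y0; nra.
have ycap : cap i s mu y by split => //; rewrite yi ltW.
(* [D] lies midway between [sqdist p y / R2] and 1. After time [h + D * h] the Gaussian at [y]
   exceeds [kappa] by a fixed amount, and this time is past [t0] because [R2^-1 < D]. *)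
pose D := (1 + sqdist p y / R2) / 2.
have yR2 : sqdist p y < R2 by rewrite pE yi y0 /R2; nra.
have yR21 : sqdist p y / R2 < 1 by rewrite ltr_pdivrMr// mul1r.
have yR20 : R2^-1 <= sqdist p y / R2.
  by rewrite -[leLHS]mul1r ler_pM2r ?invr_gt0// p_ge1.
have R2V : 0 < R2^-1 by rewrite invr_gt0.
have D0 : 0 < D by rewrite /D; lra.
have D1 : D < 1 by rewrite /D; lra.
exists (c1 * (expR (- (a * sqdist p y / (D * h))) - kappa)), (h + D * h); split.
- rewrite mulr_gt0// subr_gt0 ltr_expR ltrN2.
  rewrite (_ : a * _ / (D * h) = a / h * (sqdist p y / D)); last first.
    by field; rewrite !gt_eqF.
  rewrite (mulrAC a R2) ltr_pM2l; last exact: divr_gt0.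
  rewrite ltr_pdivrMr// (_ : R2 * D = (R2 + sqdist p y) / 2); first by lra.
  by rewrite /D; field; rewrite gt_eqF.
- by move: h0 D1; rewrite /h; nra.
- move=> t /andP[ht tT].
  have Dh : 0 < D * h by rewrite mulr_gt0.
  have t0t : t0 < t.
    apply: le_lt_trans ht; rewrite /t0 lerD2l mulrC ler_pM2r//.
    by move: yR20 yR21; rewrite /D; lra.
  have tT' : 0 < t < T by rewrite tT andbT; lra.
  have := key _ _ ycap (_ : t0 < t < T); rewrite t0t tT => /(_ isT).
  have : u (g y) t < 1.
    by apply: mems_lt1 => //; apply: reflect_cap_ball => //; exact: ltW.
  have : c1 * (expR (- (a * sqdist p y / (D * h))) - kappa) <= z y t.
    have hDt : (t - h)^-1 <= (D * h)^-1 by rewrite lef_pV2 ?posrE; lra.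
    rewrite ler_pM2l// lerD2r ler_expR lerN2; apply: ler_wpM2l hDt.
    exact: mulr_ge0 (ltW a0) (sqdist_ge0 _ _).
  by rewrite -/y; lra.
Qed.

End mems.

(** * Determination of the quenching set *)

Theorem theorem4p1 (R : realType) (N : nat) (lam Tq : R)
    (u0 : 'rV[R]_N -> R) (u : 'rV[R]_N -> R -> R) :
  (1 <= N)%N ->
  0 < lam ->
  {within @closed_unit_ball R N, continuous u0} ->
  (forall x, closed_unit_ball x -> 0 <= u0 x < 1) ->
  radially_decreasing u0 ->
  0 < Tq ->
  mems_solution lam u0 Tq u ->
  (exists xs, quenches_at u Tq xs) ->
  quenching_set u Tq = [set 0].
Proof.
move=> _ lam0 _ u0_bd u0_decr T0 sol [xs0 [x0_ [t0_ [x0B _ t0T u0_1]]]].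
have u0_ge0 x : closed_unit_ball x -> 0 <= u0 x by move=> /u0_bd /andP[].
apply/seteqP; split => [xs [xsB [x_ [t_ [xB x_xs t_T u_1]]]]|_ ->] /=.
  apply/rowP => i; rewrite mxE; apply/eqP/negPn/negP => xsi0.
  (* Halving leaves room: far along the sequence the [i]-th coordinate exceeds [rho] in modulus. *)
  pose s : R := Num.sg (xs ord0 i); pose rho := `|xs ord0 i| / 2.
  have nx0 : 0 < `|xs ord0 i| by rewrite normr_gt0.
  have s1 : s ^+ 2 = 1 by rewrite /s sqr_sg xsi0.
  have nx1 : `|xs ord0 i| <= 1.
    move: xsB; rewrite closed_unit_ballE; apply: contraTT; rewrite -!ltNge => h.
    apply: lt_le_trans (sqdist_ge_coord 0 xs i); rewrite mxE subr0.
    by rewrite -real_normK ?num_real// exprn_egt1.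
  have rho01 : 0 < rho < 1 by rewrite /rho; lra.
  have [c [t1 [c0 t1T gap]]] := quenching_gap lam0 u0_ge0 u0_decr sol i s1 rho01 T0.
  have Hu : \forall k \near \oo, 1 - c < u (x_ k) (t_ k).
    by apply: (u_1 _ (lt_nbhsr _)); lra.
  have Ht : \forall k \near \oo, t1 < t_ k by exact: (t_T _ (lt_nbhsr t1T)).
  have Hx : \forall k \near \oo, rho < `|x_ k ord0 i|.
    have cx : `|x_ k ord0 i| @[k --> \oo] --> `|xs ord0 i|.
      have cc : y ord0 i @[y --> xs] --> xs ord0 i by exact: coord_continuous.
      exact: cvg_norm (cvg_comp _ _ x_xs cc).
    by apply: (cx _ (lt_nbhsr _)); rewrite /rho; lra.
  have [k [[uk tk] xk]] := filter_ex (filterI (filterI Hu Ht) Hx).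
  have [xkB tkT] := xB k; have /andP[tk0 tkT'] := tkT.
  (* Erasing the other coordinates and shrinking the [i]-th one to modulus [rho] can only raise [u],
     so the gap on the axis contradicts quenching at [xs]. *)
  have : u (x_ k) (t_ k) <= u ((s * rho) *: delta_mx ord0 i) (t_ k).
    apply: (coordinatewise_decreasing lam0 u0_ge0 u0_decr sol) => //.
      exact: unit_ball_closed.
    move=> j; rewrite !mxE eqxx /=; have [->|ji] := eqVneq j i; last first.
      by rewrite mulr0 normr0.
    rewrite mulr1 normrM /s normr_sg xsi0 mul1r ger0_norm; last by lra.
    exact: ltW.
  have := gap (t_ k); rewrite tk tkT' => /(_ isT); lra.
have B0 : unit_ball (0 : 'rV[R]_N).
  by rewrite unit_ballE /sqdist big1// => j _; rewrite mxE subr0 expr0n.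
split; first exact: unit_ball_closed.
exists (fun=> 0), t0_; split => //.
- by move=> k; split => //; have [] := x0B k.
- exact: cvg_cst.
(* At each time [u] is largest at the origin, so along the given times its value there is squeezed
   between [u (x0_ k) (t0_ k)] and 1. *)
- apply: (@squeeze_cvgr _ \oo _ _ (fun k => u (x0_ k) (t0_ k)) (fun=> 1)) => //;
    last exact: cvg_cst.
  apply: nearW => k.
  have [xkB tkT] := x0B k; apply/andP; split; last first.
    by apply/ltW/(mems_lt1 sol) => //; exact: unit_ball_closed.
  apply: (coordinatewise_decreasing lam0 u0_ge0 u0_decr sol) => //.
    exact: unit_ball_closed.
  by move=> j; rewrite mxE normr0.
Qed.
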